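(* Let $q\in(-1,1)$ and let $\{X_t\}_{t\ge 0}$ be a $q$-Brownian motion on a non-commutative probability space $(\mathcal A,\varphi)$. For every simple process $V=\sum_{i=0}^{k-1}V_{t_i}\mathbf 1_{[t_i,t_{i+1})}$ in $\mathcal A$, one has $$\Big\|\int_0^\infty V_s\otimes dX_s\Big\|_{L^\infty(\varphi\otimes\varphi)}\le \frac{2}{\sqrt{1-|q|}}\sqrt{\int_0^\infty\|V_s\|^2\,ds}.$$
   Context: A non-commutative probability space $(\mathcal A,\varphi)$ is a von Neumann algebra $\mathcal A$ of bounded operators on a complex separable Hilbert space $\mathcal H$ equipped with a trace $\varphi$: a unital, weakly continuous, positive, faithful linear functional with $\varphi(XY)=\varphi(YX)$. $\|\cdot\|$ is the operator norm. Random variables are self-adjoint elements of $\mathcal A$. A pairing of $\{1,\dots,r\}$ ($r$ even) is a partition into $r/2$ two-element blocks; $\mathcal P_2(\{1,\dots,r\})$ is the set of pairings (empty for $r$ odd). A crossing of a pairing $\pi$ is a set $\{\{x_1,y_1\},\{x_2,y_2\}\}$ with $\{x_i,y_i\}\in\pi$ and $x_1<x_2<y_1<y_2$; $\mathrm{Cr}(\pi)$ is the number of crossings. A $q$-Brownian motion on $(\mathcal A,\varphi)$ is a family $\{X_t\}_{t\ge0}$ of random variables such that for all $r\ge1$ and $t_1,\dots,t_r\ge0$, $\varphi(X_{t_1}\cdots X_{t_r})=\sum_{\pi\in\mathcal P_2(\{1,\dots,r\})}q^{\mathrm{Cr}(\pi)}\prod_{\{i,j\}\in\pi}(t_i\wedge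 t_j)$. The algebraic tensor product $\mathcal A\otimes\mathcal A$ carries the product $(U_1\otimes U_2)\cdot(V_1\otimes V_2)=(U_1V_1)\otimes(U_2V_2)$ and adjoint $(U\otimes V)^*=U^*\otimes V^*$. $L^\infty(\varphi\otimes\varphi)$ is the spatial tensor product, i.e. the von Neumann algebra generated by $\mathcal A\otimes\mathcal A$ acting on the Hilbert completion of $\mathcal H\otimes\mathcal H$, with operator norm $\|\cdot\|_{L^\infty(\varphi\otimes\varphi)}$ and trace $\varphi\otimes\varphi$. A simple process is $V=\sum_{i=0}^{k-1}V_{t_i}\mathbf 1_{[t_i,t_{i+1})}$ with $V_{t_i}\in\mathcal A$ and $0\le t_0<\dots<t_k$, and $\int_0^\infty V_s\otimes dX_s:=\sum_{i=0}^{k-1}V_{t_i}\otimes(X_{t_{i+1}}-X_{t_i})$. *)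

(* Defs.v *)
From HB Require Import structures.
From mathcomp Require Import all_boot all_order all_algebra.
From mathcomp Require Import all_classical all_reals all_analysis.
From mathcomp Require Import sesquilinear complex ring.

Set Implicit Arguments.
Unset Strict Implicit.
Unset Printing Implicit Defensive.

Import Order.TTheory GRing.Theory Num.Theory numFieldNormedType.Exports.

Local Open Scope ring_scope.
Local Open Scope complex_scope.

Definition pairings (r : nat) : {set {set {set 'I_r}}} :=
  [set P | finset.partition P [set: 'I_r] & [forall B in P, #|B| == 2]].

Definition crossings (r : nat) (P : {set {set 'I_r}}) :
    {set {set {set 'I_r}}} :=
  [set c | [exists x1 : 'I_r, exists x2 : 'I_r,
            exists y1 : 'I_r, exists y2 : 'I_r,
    [&& (x1 < x2)%N, (x2 < y1)%N, (y1 < y2)%N,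
        [set x1; y1] \in P, [set x2; y2] \in P
      & c == [set [set x1; y1]; [set x2; y2]]]]].

Definition q_moment (R : realType) (q : R) (r : nat) (t : 'I_r -> R) : R :=
  \sum_(P in pairings r) q ^+ #|crossings P| *
    \prod_(p : 'I_r * 'I_r | (p.1 < p.2)%N && ([set p.1; p.2] \in P))
      Num.min (t p.1) (t p.2).

Local Open Scope classical_set_scope.

(** The inner product is linear in its first argument. *)

HB.mixin Record CompleteNormedModule_isHilbert (R : realType) (H : Type)
    & CompleteNormedModule R[i] H := {
  inner : H -> H -> R[i];
  innerPl : forall (a : R[i]) (x y z : H),
    inner (a *: x + y) z = a * inner x z + inner y z;
  innerC : forall x y : H, inner x y = (inner y x)^*;
  inner_norm : forall x : H, inner x x = `|x| ^+ 2
}.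

#[short(type="hilbertType")]
HB.structure Definition Hilbert (R : realType) :=
  {H of CompleteNormedModule R[i] H & CompleteNormedModule_isHilbert R H}.

Definition separable (T : topologicalType) :=
  exists2 D : set T, countable D & dense D.

Section InnerTheory.
Context {R : realType} {H : hilbertType R}.
Implicit Types (x y z : H) (a : R[i]).

Lemma innerDl x y z : inner (x + y) z = inner x z + inner y z.
Proof. by rewrite -[x]scale1r innerPl mul1r scale1r. Qed.

Lemma inner0l z : inner 0 z = 0.
Proof. by apply: (addrI (inner 0 z)); rewrite -innerDl !addr0. Qed.

Lemma innerZl a x z : inner (a *: x) z = a * inner x z.
Proof. by rewrite -[a *: x]addr0 innerPl inner0l addr0. Qed.

Lemma innerDr x y z : inner x (y + z) = inner x y + inner x z.
Proof. by rewrite innerC innerDl rmorphD /= -!innerC. Qed.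

Lemma innerZr a x z : inner x (a *: z) = a^* * inner x z.
Proof. by rewrite innerC innerZl rmorphM /= -innerC. Qed.

Lemma inner0r x : inner x 0 = 0.
Proof. by rewrite innerC inner0l rmorph0. Qed.

Lemma inner_suml (I : Type) (r : seq I) (P : pred I) (F : I -> H) z :
  inner (\sum_(i <- r | P i) F i) z = \sum_(i <- r | P i) inner (F i) z.
Proof.
by apply: (big_morph (inner^~ z)) => [x y|]; rewrite ?innerDl ?inner0l.
Qed.

Lemma inner_sumr (I : Type) (r : seq I) (P : pred I) (F : I -> H) z :
  inner z (\sum_(i <- r | P i) F i) = \sum_(i <- r | P i) inner z (F i).
Proof.
by apply: (big_morph (inner z)) => [x y|]; rewrite ?innerDr ?inner0r.
Qed.

End InnerTheory.

Record bop (R : realType) (H : hilbertType R) := Bop {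
  bop_fun :> H -> H;
  bop_linear : linear bop_fun;
  bop_bounded : exists M : R, forall x : H, `|bop_fun x| <= M%:C * `|x|
}.

Section BopAlgebra.
Context {R : realType} {H : hilbertType R}.
Implicit Types (S T U : bop H).

HB.instance Definition _ := gen_eqMixin (bop H).
HB.instance Definition _ := gen_choiceMixin (bop H).
HB.instance Definition _ T :=
  GRing.isLinear.Build R[i] H H _ (bop_fun T) (bop_linear T).

Lemma bopP S T : (forall x, S x = T x) -> S = T.
Proof.
case: S T => [f fl fb] [g gl gb] /= /funext fg.
by subst g; congr Bop; exact: Prop_irrelevance.
Qed.

Fact bop_zero_linear : linear (fun _ : H => 0 : H).
Proof. by move=> a x y; rewrite scaler0 addr0. Qed.
Fact bop_zero_bounded :
  exists M : R, forall x : H, `|0 : H| <= M%:C * `|x|.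
Proof. by exists 0 => x; rewrite normr0 mul0r. Qed.
Definition bop_zero := Bop bop_zero_linear bop_zero_bounded.

Fact bop_one_linear : linear (@id H). Proof. by []. Qed.
Fact bop_one_bounded : exists M : R, forall x : H, `|x| <= M%:C * `|x|.
Proof. by exists 1 => x; rewrite mul1r. Qed.
Definition bop_one := Bop bop_one_linear bop_one_bounded.

Fact bop_add_linear S T : linear (fun x => S x + T x).
Proof. by move=> a x y; rewrite !linearP scalerDr addrACA. Qed.
Fact bop_add_bounded S T :
  exists M : R, forall x : H, `|S x + T x| <= M%:C * `|x|.
Proof.
have [M1 h1] := bop_bounded S; have [M2 h2] := bop_bounded T.
exists (M1 + M2) => x; rewrite rmorphD mulrDl.
by rewrite (le_trans (ler_normD _ _))// lerD.
Qed.
Definition bop_add S T := Bop (bop_add_linear S T) (bop_add_bounded S T).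

Fact bop_scale_linear (c : R[i]) T : linear (fun x => c *: T x).
Proof. by move=> a x y; rewrite linearP scalerDr !scalerA mulrC. Qed.
Fact bop_scale_bounded (c : R[i]) T :
  exists M : R, forall x : H, `|c *: T x| <= M%:C * `|x|.
Proof.
have [M h] := bop_bounded T; exists (complex.Re `|c| * M) => x.
have hc : (complex.Re `|c|)%:C = `|c| by exact: RRe_real (normr_real _).
rewrite normrZ rmorphM -mulrA -[X in X * `|T x|]hc.
by apply: ler_wpM2l => //; rewrite hc.
Qed.
Definition bop_scale c T := Bop (bop_scale_linear c T) (bop_scale_bounded c T).

Definition bop_opp T := bop_scale (-1) T.

Fact bop_mul_linear S T : linear (fun x => S (T x)).
Proof. by move=> a x y; rewrite !linearP. Qed.
Fact bop_mul_bounded S T :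
  exists M : R, forall x : H, `|S (T x)| <= M%:C * `|x|.
Proof.
have [M1 h1] := bop_bounded S; have [M2 h2] := bop_bounded T.
exists (`|M1| * M2) => x; rewrite rmorphM -mulrA.
apply: (le_trans (h1 _)); apply: (@le_trans _ _ (`|M1|%:C * `|T x|)).
  by rewrite ler_wpM2r// lecR ler_norm.
by rewrite ler_wpM2l// lecR.
Qed.
Definition bop_mul S T := Bop (bop_mul_linear S T) (bop_mul_bounded S T).

Fact bop_addA : associative bop_add.
Proof. by move=> S T U; apply: bopP => x /=; rewrite addrA. Qed.
Fact bop_addC : commutative bop_add.
Proof. by move=> S T; apply: bopP => x /=; rewrite addrC. Qed.
Fact bop_add0 : left_id bop_zero bop_add.
Proof. by move=> T; apply: bopP => x /=; rewrite add0r. Qed.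
Fact bop_addN : left_inverse bop_zero bop_opp bop_add.
Proof. by move=> T; apply: bopP => x /=; rewrite scaleN1r addNr. Qed.
HB.instance Definition _ :=
  GRing.isZmodule.Build (bop H) bop_addA bop_addC bop_add0 bop_addN.

Fact bop_mulA : associative bop_mul.
Proof. by move=> S T U; apply: bopP. Qed.
Fact bop_mul1 : left_id bop_one bop_mul.
Proof. by move=> T; apply: bopP. Qed.
Fact bop_mulr1 : right_id bop_one bop_mul.
Proof. by move=> T; apply: bopP. Qed.
Fact bop_mulDl : left_distributive bop_mul (@GRing.add (bop H)).
Proof. by move=> S T U; apply: bopP. Qed.
Fact bop_mulDr : right_distributive bop_mul (@GRing.add (bop H)).
Proof. by move=> S T U; apply: bopP => x /=; rewrite linearD. Qed.
HB.instance Definition _ := GRing.Zmodule_isPzRing.Build (bop H)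
  bop_mulA bop_mul1 bop_mulr1 bop_mulDl bop_mulDr.

Fact bop_scaleA (a b : R[i]) T :
  bop_scale a (bop_scale b T) = bop_scale (a * b) T.
Proof. by apply: bopP => x /=; rewrite scalerA. Qed.
Fact bop_scale1 : left_id 1 bop_scale.
Proof. by move=> T; apply: bopP => x /=; rewrite scale1r. Qed.
Fact bop_scaleDr : right_distributive bop_scale +%R.
Proof. by move=> a S T; apply: bopP => x /=; rewrite scalerDr. Qed.
Fact bop_scaleDl T : {morph bop_scale^~ T : a b / a + b}.
Proof. by move=> a b; apply: bopP => x /=; rewrite scalerDl. Qed.
HB.instance Definition _ := GRing.Zmodule_isLmodule.Build R[i] (bop H)
  bop_scaleA bop_scale1 bop_scaleDr bop_scaleDl.

Lemma bop_addE S T x : (S + T) x = S x + T x. Proof. by []. Qed.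
Lemma bop_oppE T x : (- T) x = - T x. Proof. exact: scaleN1r. Qed.
Lemma bop_scaleE (a : R[i]) T x : (a *: T) x = a *: T x. Proof. by []. Qed.
Lemma bop_mulE S T x : (S * T) x = S (T x). Proof. by []. Qed.
Lemma bop_oneE x : (1 : bop H) x = x. Proof. by []. Qed.

Definition opnorm T : R :=
  sup [set complex.Re `|T x| | x in [set x : H | `|x| <= 1]].

Definition is_adjoint T U := forall x y : H, inner (T x) y = inner x (U y).

Definition self_adjoint T := is_adjoint T T.

End BopAlgebra.

(** The weak operator topology: the initial topology of the matrix
    coefficients [T |-> <T x, y>] *)

Definition wot_coef (R : realType) (H : hilbertType R) (T : bop H) :
    {ptws (H * H)%type -> R[i]^o} :=
  fun p => inner (T p.1) p.2.

Notation wot H := (initial_topology (@wot_coef _ H)).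

Record von_neumann_algebra (R : realType) (H : hilbertType R)
    (A : set (bop H)) : Prop := VonNeumannAlgebra {
  vna_one : A 1;
  vna_lin : forall (a : R[i]) (S T : bop H), A S -> A T -> A (a *: S + T);
  vna_mul : forall S T : bop H, A S -> A T -> A (S * T);
  vna_adj : forall T : bop H, A T -> exists2 U, A U & is_adjoint T U;
  vna_closed : closed (A : set (wot H))
}.

(* [phi] is a function on [A]: its values outside [A] are irrelevant. *)
Record is_trace (R : realType) (H : hilbertType R) (A : set (bop H))
    (phi : bop H -> R[i]) : Prop := IsTrace {
  trace_lin : forall (a : R[i]) (S T : bop H), A S -> A T ->
    phi (a *: S + T) = a * phi S + phi T;
  trace_one : phi 1 = 1;
  trace_wcts : {within (A : set (wot H)), continuous (phi : wot H -> R[i]^o)};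
  trace_pos : forall S T : bop H, A S -> A T -> is_adjoint S T ->
    0 <= phi (T * S);
  trace_faithful : forall S T : bop H, A S -> A T -> is_adjoint S T ->
    phi (T * S) = 0 -> S = 0;
  trace_comm : forall S T : bop H, A S -> A T -> phi (S * T) = phi (T * S)
}.

Record nc_probability_space (R : realType) (H : hilbertType R)
    (A : set (bop H)) (phi : bop H -> R[i]) : Prop := NCProbabilitySpace {
  ncps_separable : separable H;
  ncps_vna : von_neumann_algebra A;
  ncps_trace : is_trace A phi
}.

Record q_brownian_motion (R : realType) (H : hilbertType R)
    (A : set (bop H)) (phi : bop H -> R[i]) (q : R) (X : R -> bop H) : Prop :=
  QBrownianMotion {
  qbm_mem : forall t, 0 <= t -> A (X t);
  qbm_sa : forall t, 0 <= t -> self_adjoint (X t);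
  qbm_moment : forall (r : nat) (t : 'I_r -> R), (0 < r)%N ->
    (forall i, 0 <= t i) ->
    phi (\prod_(i < r) X (t i)) = (q_moment q t)%:C
}.

(** The Hilbert tensor product, i.e. the completion of the algebraic tensor
    product, is unique up to a unitary compatible with the tensors, so we work
    with an arbitrary realization of it: a Hilbert space with a bilinear map
    having the required inner products and a dense span. *)

Record hilbert_tensor (R : realType) (H1 H2 : hilbertType R) := HilbertTensor {
  ht_space :> hilbertType R;
  tens : {bilinear H1 -> H2 -> ht_space};
  inner_tens : forall x1 y1 x2 y2,
    inner (tens x1 x2) (tens y1 y2) = inner x1 y1 * inner x2 y2;
  tens_dense : dense [set z : ht_space | exists (n : nat) (x : 'I_n -> H1)
    (y : 'I_n -> H2), z = \sum_(i < n) tens (x i) (y i)]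
}.

(* Existence of [U (x) V]: a bound on the algebraic tensor product (the entrywise
   product of two Gram matrices is positive), then extension by density. *)
Section TensorOp.
Context {R : realType}.

Lemma inner_ge0 (H : hilbertType R) (x : H) : 0 <= inner x x.
Proof. by rewrite inner_norm exprn_ge0. Qed.

Lemma gram_prod_ge0 (V : lmodType R[i]) (g : V -> V -> R[i]) (H : hilbertType R)
    (gl : forall a x y z, g (a *: x + y) z = a * g x z + g y z)
    (gr : forall a x y z, g z (a *: x + y) = a^* * g z x + g z y)
    (g0 : forall x, 0 <= g x x) (n : nat) (x : nat -> V) (y : nat -> H) :
  0 <= \sum_(i < n) \sum_(j < n) g (x i) (x j) * inner (y i) (y j).
Proof.
have gl0 z : g 0 z = 0.
  apply: (addrI (g 0 z)); rewrite addr0.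
  by have := gl 1 0 0 z; rewrite scaler0 addr0 mul1r.
have gr0 z : g z 0 = 0.
  apply: (addrI (g z 0)); rewrite addr0.
  by have := gr 1 0 0 z; rewrite scaler0 addr0 rmorph1 mul1r.
have gsl (m : nat) (c : nat -> R[i]) z :
    g (\sum_(i < m) c i *: x i) z = \sum_(i < m) c i * g (x i) z.
  elim: m => [|m IH]; first by rewrite !big_ord0 gl0.
  by rewrite !big_ord_recr/= addrC gl IH addrC.
have gsr (m : nat) (c : nat -> R[i]) z :
    g z (\sum_(i < m) c i *: x i) = \sum_(i < m) (c i)^* * g z (x i).
  elim: m => [|m IH]; first by rewrite !big_ord0 gr0.
  by rewrite !big_ord_recr/= addrC gr IH addrC.
elim: n => [|n IH] in y *; first by rewrite big_ord0.
pose N := inner (y n) (y n).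
pose c i := inner (y i) (y n) / N.
pose z i := y i - c i *: y n.
have N0 : N = 0 -> y n = 0.
  by rewrite /N inner_norm => /eqP; rewrite expf_eq0/= normr_eq0 => /eqP.
have cN i : c i * N = inner (y i) (y n).
  have [/N0 yn0|Nn0] := eqVneq N 0; first by rewrite /c/N yn0 !inner0r mulr0.
  by rewrite /c divfK.
have yE i : y i = c i *: y n + z i by rewrite addrC subrK.
have zy i : inner (z i) (y n) = 0.
  apply: (addrI (c i * N)).
  by rewrite addr0 -innerPl -yE cN.
have yz i : inner (y n) (z i) = 0 by rewrite innerC zy rmorph0.
have zn : z n = 0.
  have [/N0 yn0|Nn0] := eqVneq N 0; first by rewrite /z yn0 scaler0 subr0.
  by rewrite /z /c -/N divff// scale1r subrr.
have E i j : inner (y i) (y j) = c i * (c j)^* * N + inner (z i) (z j).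
  rewrite [in LHS](yE i) [in LHS](yE j) innerPl innerDr innerZr yz addr0.
  by rewrite innerDr innerZr zy mulr0 add0r mulrA.
under eq_bigr do under eq_bigr do rewrite E mulrDr.
under eq_bigr do rewrite big_split/=.
rewrite big_split/= addr_ge0//.
  have -> : \sum_(i < n.+1) \sum_(j < n.+1) g (x i) (x j) * (c i * (c j)^* * N)
      = N * g (\sum_(i < n.+1) c i *: x i) (\sum_(i < n.+1) c i *: x i).
    rewrite gsl mulr_sumr; apply: eq_bigr => i _.
    rewrite gsr mulrA mulr_sumr; apply: eq_bigr => j _.
    by ring.
  by rewrite mulr_ge0// inner_ge0.
rewrite big_ord_recr/= [X in _ + X]big1; last first.
  by move=> j _; rewrite zn inner0l mulr0.
rewrite addr0; under eq_bigr do rewrite big_ord_recr/= zn inner0r mulr0 addr0.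
exact: IH.
Qed.

Lemma bop_extension (K : hilbertType R) (G : set (K * K)) (M : R)
    (M0 : 0 <= M)
    (Glin : forall a p p', G p -> G p' -> G (a *: p.1 + p'.1, a *: p.2 + p'.2))
    (Gbnd : forall p, G p -> `|p.2| <= M%:C * `|p.1|)
    (Gdense : dense [set p.1 | p in G]) :
  exists T : bop K, forall p, G p -> T p.1 = p.2.
Proof.
have MC0 : 0 <= M%:C :> R[i] by rewrite lecR.
have near z e : 0 < e :> R[i] -> exists2 p, G p & `|p.1 - z| < e.
  move=> e0; have [] := Gdense (ball z e).
  - by exists z; exact: ballxx.
  - exact: ball_open.
  move=> y [zy [p Gp py]]; exists p => //; rewrite py distrC.
  by rewrite -ball_normE in zy.
pose cl z w := forall e : R[i], 0 < e ->
  exists p, [/\ G p, `|p.1 - z| < e & `|p.2 - w| < e].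
have clG p : G p -> cl p.1 p.2.
  by move=> Gp e e0; exists p; rewrite !subrr normr0.
have M1 : 0 < M%:C + 1 :> R[i] by rewrite ltr_wpDl.
have cl_lin a z w z' w' : cl z w -> cl z' w' ->
    cl (a *: z + z') (a *: w + w').
  move=> h h' e e0.
  have a1 : 0 < `|a| + 1 :> R[i] by rewrite ltr_wpDl.
  have d0 : 0 < e / (`|a| + 1) by rewrite divr_gt0.
  have [p [Gp p1 p2]] := h _ d0; have [p' [Gp' p1' p2']] := h' _ d0.
  exists (a *: p.1 + p'.1, a *: p.2 + p'.2) => /=.
  have aux (u v u' v' : K) : `|u - v| < e / (`|a| + 1) ->
      `|u' - v'| < e / (`|a| + 1) -> `|a *: u + u' - (a *: v + v')| < e.
    move=> uv uv'; rewrite opprD addrACA -scalerBr.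
    rewrite (le_lt_trans (ler_normD _ _))// normrZ.
    have -> : e = `|a| * (e / (`|a| + 1)) + e / (`|a| + 1).
      by rewrite -[X in _ + X]mul1r -mulrDl mulrC divfK// gt_eqF.
    by rewrite ler_ltD// ler_wpM2l// ltW.
  by split; [exact: Glin|exact: aux|exact: aux].
have cl_bnd z w : cl z w -> `|w| <= M%:C * `|z|.
  move=> h; apply/ler_addgt0Pr => e e0.
  have d0 : 0 < e / (M%:C + 1) by rewrite divr_gt0.
  have [p [Gp p1 p2]] := h _ d0.
  have -> : w = p.2 - (p.2 - w) by rewrite subKr.
  rewrite (le_trans (ler_normB _ _))//.
  have -> : e = M%:C * (e / (M%:C + 1)) + e / (M%:C + 1).
    by rewrite -[X in _ + X]mul1r -mulrDl mulrC divfK// gt_eqF.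
  rewrite addrA lerD ?(ltW p2)// (le_trans (Gbnd _ Gp))// -mulrDr ler_wpM2l//.
  have -> : p.1 = z + (p.1 - z) by rewrite addrC subrK.
  by rewrite (le_trans (ler_normD _ _))// lerD// ltW// addrC addKr.
have cl_uniq z w w' : cl z w -> cl z w' -> w = w'.
  move=> h h'; have := cl_lin (-1) _ _ _ _ h h'.
  rewrite !scaleN1r addNr => /cl_bnd; rewrite normr0 mulr0 normr_le0.
  by rewrite addrC subr_eq0 => /eqP.
have cl_ex z : exists w, cl z w.
  pose B (e : R[i]) := [set p.2 | p in [set p | G p /\ `|p.1 - z| < e]].
  pose F := filter_from [set e : R[i] | 0 < e] B.
  have FF : ProperFilter F.
    apply: filter_from_proper.
      apply: filter_from_filter; first by exists 1 => /=.
      move=> e1 e2 /= e10 e20; have e12 : 0 < e1 + e2 by rewrite addr_gt0.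
      exists (e1 * e2 / (e1 + e2)); first by rewrite /= divr_gt0 ?mulr_gt0.
      move=> _ [p [Gp pz] <-]; split; exists p => //; split => //;
        apply: (lt_le_trans pz); rewrite ler_pdivrMr//.
        by rewrite ler_pM2l// lerDr ltW.
      by rewrite mulrC ler_pM2l// lerDl ltW.
    by move=> e e0; have [p Gp pz] := near z e e0; exists p.2, p.
  have : cvg F.
    apply: cauchy_cvg; apply: cauchy_exP => e e0.
    have d0 : 0 < e / (M%:C + M%:C + 1).
      by rewrite divr_gt0// ltr_wpDl// addr_ge0.
    have [p0 Gp0 p0z] := near z _ d0.
    exists p0.2, (e / (M%:C + M%:C + 1)) => //.
    move=> _ [p [Gp pz] <-]; rewrite -ball_normE/=.
    have -> : p0.2 - p.2 = (-1) *: p.2 + p0.2 by rewrite scaleN1r addrC.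
    have := Gbnd _ (Glin (-1) _ _ Gp Gp0) => /= /le_lt_trans; apply.
    have -> : (-1) *: p.1 + p0.1 = (p0.1 - z) - (p.1 - z).
      by rewrite scaleN1r opprB addrA subrK addrC.
    have : M%:C * `|p0.1 - z - (p.1 - z)|
        <= (M%:C + M%:C) * (e / (M%:C + M%:C + 1)).
      rewrite mulrDl -mulrDr ler_wpM2l// (le_trans (ler_normB _ _))//.
      by rewrite lerD// ltW.
    move=> /le_lt_trans; apply.
    rewrite mulrCA gtr_pMr// ltr_pdivrMr ?mul1r ?ltrDl//.
    by rewrite ltr_wpDl// addr_ge0.
  move=> /cvg_ex[w Fw]; exists w => e e0.
  have /Fw [d d0 dB] : nbhs w (ball w e) by exact: nbhsx_ballx.
  pose d' := d * e / (d + e).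
  have de : 0 < d + e by rewrite addr_gt0.
  have d'0 : 0 < d' by rewrite /d' divr_gt0 ?mulr_gt0.
  have [p Gp pz] := near z _ d'0; exists p; split => //.
    apply: (lt_le_trans pz).
    by rewrite ler_pdivrMr// mulrC ler_pM2l// lerDl ltW.
  have /dB : B d p.2.
    exists p => //; split => //.
    by apply: (lt_le_trans pz); rewrite ler_pdivrMr// ler_pM2l// lerDr ltW.
  by rewrite -ball_normE/= distrC.
have [f fP] := choice cl_ex.
have f_lin : linear f.
  by move=> a x y; apply: (cl_uniq (a *: x + y)) => //; exact: cl_lin.
have f_bnd : exists M : R, forall x, `|f x| <= M%:C * `|x|.
  by exists M => x; exact: cl_bnd.
by exists (Bop f_lin f_bnd) => p Gp /=; exact: (cl_uniq p.1 _ _ _ (clG _ Gp)).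
Qed.

Context {H1 H2 : hilbertType R} (K : hilbert_tensor H1 H2).

Lemma bop_bounded_ge0 (H : hilbertType R) (T : bop H) :
  exists2 M : R, 0 <= M & forall x, `|T x| <= M%:C * `|x|.
Proof.
have [M h] := bop_bounded T; exists `|M| => // x.
by rewrite (le_trans (h x))// ler_wpM2r// lecR ler_norm.
Qed.

Lemma bop_form_ge0 (H : hilbertType R) (T : bop H) (M : R) (M0 : 0 <= M)
    (h : forall x, `|T x| <= M%:C * `|x|) (n : nat) (H' : hilbertType R)
    (x : 'I_n -> H) (y : 'I_n -> H') :
  \sum_(i < n) \sum_(j < n) inner (T (x i)) (T (x j)) * inner (y i) (y j) <=
  M%:C ^+ 2 * \sum_(i < n) \sum_(j < n) inner (x i) (x j) * inner (y i) (y j).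
Proof.
pose g (u v : H) := M%:C ^+ 2 * inner u v - inner (T u) (T v).
have xE (i : 'I_n) : oapp x 0 (insub (i : nat)) = x i by rewrite valK.
have yE (i : 'I_n) : oapp y 0 (insub (i : nat)) = y i by rewrite valK.
have gram : 0 <= \sum_(i < n) \sum_(j < n) g (x i) (x j) * inner (y i) (y j).
  rewrite (_ : \sum_(i < n) _ = \sum_(i < n) \sum_(j < n)
      g (oapp x 0 (insub (i : nat))) (oapp x 0 (insub (j : nat))) *
      inner (oapp y 0 (insub (i : nat))) (oapp y 0 (insub (j : nat)))); last first.
    by apply: eq_bigr => i _; apply: eq_bigr => j _; rewrite !xE !yE.
  apply: (@gram_prod_ge0 H g H' _ _ _ n
    (fun k => oapp x 0 (insub k)) (fun k => oapp y 0 (insub k))).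
  - by move=> a u v w; rewrite /g linearP !innerPl; ring.
  - by move=> a u v w; rewrite /g linearP !innerDr !innerZr; ring.
  - move=> u; rewrite /g !inner_norm subr_ge0 -exprMn.
    by rewrite ler_pXn2r// ?nnegrE// mulr_ge0// lecR.
rewrite -subr_ge0; move: gram; congr (is_true (0 <= _)); symmetry.
rewrite mulr_sumr -sumrB; apply: eq_bigr => i _.
rewrite mulr_sumr -sumrB; apply: eq_bigr => j _.
by rewrite mulrBl mulrA.
Qed.

Lemma norm_tens_sum (n : nat) (x : 'I_n -> H1) (y : 'I_n -> H2) :
  `|\sum_(i < n) tens K (x i) (y i)| ^+ 2 =
  \sum_(i < n) \sum_(j < n) inner (x i) (x j) * inner (y i) (y j).
Proof.
rewrite -inner_norm inner_suml; apply: eq_bigr => i _.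
by rewrite inner_sumr; apply: eq_bigr => j _; rewrite inner_tens.
Qed.

Lemma tensor_op_ex (U : bop H1) (V : bop H2) :
  exists W : bop K, forall x y, W (tens K x y) = tens K (U x) (V y).
Proof.
have [M M0 hM] := bop_bounded_ge0 U; have [N N0 hN] := bop_bounded_ge0 V.
have MC0 : 0 <= M%:C :> R[i] by rewrite lecR.
have NC0 : 0 <= N%:C :> R[i] by rewrite lecR.
pose G := [set p : K * K | exists n (x : 'I_n -> H1) (y : 'I_n -> H2),
  p = (\sum_(i < n) tens K (x i) (y i),
       \sum_(i < n) tens K (U (x i)) (V (y i)))].
have [| | | |W hW] := @bop_extension K G (M * N).
- by rewrite mulr_ge0.
- move=> a _ _ [n [x [y ->]]] [n' [x' [y' ->]]] /=.
  exists (n + n')%N, (fun k => match fintype.split k with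
                              | inl i => a *: x i | inr i => x' i end),
    (fun k => match fintype.split k with inl i => y i | inr i => y' i end).
  rewrite !big_split_ord/= !scaler_sumr.
  by congr (_ + _, _ + _); apply: eq_bigr => i _;
    rewrite ?(unsplitK (inl i)) ?(unsplitK (inr i)) ?linearZ//= linearZl_LR.
- move=> _ [n [x [y ->]]] /=.
  rewrite -(@ler_pXn2r _ 2)// ?nnegrE ?mulr_ge0// ?lecR ?mulr_ge0//.
  rewrite exprMn !norm_tens_sum rmorphM exprMn -mulrA.
  apply: le_trans (bop_form_ge0 M0 hM x (V \o y)) _ => /=.
  rewrite ler_wpM2l ?exprn_ge0//.
  under eq_bigr do under eq_bigr do rewrite mulrC.
  apply: le_trans (bop_form_ge0 N0 hN y x) _ => /=.
  rewrite ler_wpM2l ?exprn_ge0//.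
  by apply: ler_sum => i _; apply: ler_sum => j _; rewrite mulrC.
- move=> O O0 Oo; have [z [Oz [n [x [y zE]]]]] := tens_dense O0 Oo.
  exists z; split => //; exists (z, \sum_(i < n) tens K (U (x i)) (V (y i))) => //.
  by exists n, x, y; rewrite zE.
exists W => x y.
apply: (hW (tens K x y, tens K (U x) (V y))).
by exists 1%N, (fun=> x), (fun=> y); rewrite !big_ord1.
Qed.

(** [U (x) V] is the bounded operator on the Hilbert tensor product determined by
    its values on the pure tensors. The norm of [L^oo(phi (x) phi)], the von
    Neumann algebra generated by these operators for [U], [V] in [A], is the
    operator norm of [bop K]. *)
Definition tensor_op (U : bop H1) (V : bop H2) : bop K :=
  xget 0 [set W : bop K | forall x y, W (tens K x y) = tens K (U x) (V y)].

Lemma tensor_opE (U : bop H1) (V : bop H2) (x : H1) (y : H2) :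
  tensor_op U V (tens K x y) = tens K (U x) (V y).
Proof.
rewrite /tensor_op; case: xgetP => [W _ hW|none]; first exact: hW.
by have [W hW] := tensor_op_ex U V; case: (none W).
Qed.

End TensorOp.

Record simple_process (R : realType) (H : hilbertType R) (A : set (bop H)) :=
  SimpleProcess {
  sp_size : nat;
  sp_time : nat -> R;
  sp_val : nat -> bop H;
  sp_time0 : 0 <= sp_time 0;
  sp_timeS : forall i, (i < sp_size)%N -> sp_time i < sp_time i.+1;
  sp_mem : forall i, (i < sp_size)%N -> A (sp_val i)
}.

Definition sp_fun (R : realType) (H : hilbertType R) (A : set (bop H))
    (V : simple_process A) (s : R) : bop H :=
  \sum_(i < sp_size V)
    (\1_(`[sp_time V i, sp_time V i.+1[ : set R) s : R)%:C *: sp_val V i.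

Coercion sp_fun : simple_process >-> Funclass.

Definition stoch_int (R : realType) (H : hilbertType R) (A : set (bop H))
    (K : hilbert_tensor H H) (V : simple_process A) (X : R -> bop H) : bop K :=
  \sum_(i < sp_size V)
    tensor_op K (sp_val V i) (X (sp_time V i.+1) - X (sp_time V i)).

(* Main.v *)
(** Write M for the integral, sum_i V_i (x) (X_(t_(i+1)) - X_(t_i)), and
    N = M^* M. The operator norm of M is read off the growth of the moments
    (phi (x) phi)(N^r).

    Moments: expanding N^r gives words phi(V_(i_1)^* V_(i_2) ...), bounded by
    the product of the norms, times q-moments of the increments, which vanish
    unless the indices agree along a pairing. Hence (phi (x) phi)(N^r) is at most
    (sum_i |V_i|^2 (t_(i+1) - t_i))^r sum_P |q|^(crossings P) up to a constant,
    over the pairings P of 2r points. A pairing is determined by the set of its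
    right endpoints together with the number of crossings charged to each of
    them, so the last sum is at most 2^(2r) (1 - |q|)^(-r).

    Norms: phi is continuous for the weak operator topology, hence a finite sum
    of matrix coefficients on A, so phi (x) phi makes sense on all operators.
    Slicing shows that it is positive and faithful on the norm closure of the
    algebraic tensor product. If N^2 is not bounded by L', the operator
    Q = W + sqrt(W^2), W = N^2 - L', is nonzero there and satisfies
    L'^r Q^2 <= Q N^(2r) Q <= |Q|^2 N^(2r), so that the moments of N^2 grow at
    least like L'^r. *)

Require Import Defs.
From mathcomp Require Import all_boot all_order all_algebra.
From mathcomp Require Import all_classical all_reals all_analysis.
From mathcomp Require Import complex measurable_realfun ring lra zify.
Import Order.TTheory GRing.Theory Num.Theory numFieldNormedType.Exports.

Set Implicit Arguments.
Unset Strict Implicit.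
Unset Printing Implicit Defensive.

Local Open Scope ring_scope.

(** * Pairings and q-moments *)

Section Pairings.
Context {n : nat}.
Implicit Types (P : {set {set 'I_n}}) (i j : 'I_n).

(** Presents a pairing as a fixed-point-free involution. The default [j] is never returned when [P]
    is a pairing. *)
Definition partner P j : 'I_n :=
  odflt j [pick i | (i != j) && ([set j; i]%SET \in P)].

Lemma partnerP P j : P \in pairings n ->
  (partner P j != j) /\ [set j; partner P j]%SET \in P.
Proof.
rewrite inE => /andP[/and3P[/eqP cov _ _] /forallP c2].
rewrite /partner; case: pickP => [i /andP[]//|none].
have : j \in finset.cover P by rewrite cov finset.in_setT.
case/finset.bigcupP => B BP jB.
have := c2 B; rewrite BP => /cards2P[a [b [ab BE]]].
move: jB; rewrite BE finset.in_set2 => /orP[] /eqP jE.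
  by have := none b; rewrite jE eq_sym ab -BE BP.
by have := none a; rewrite jE ab finset.setUC -BE BP.
Qed.

Lemma partner_eq P i j : P \in pairings n -> [set i; j]%SET \in P ->
  partner P i = j.
Proof.
move=> PP ijP; have [pi piP] := partnerP i PP.
move: PP; rewrite inE => /andP[/and3P[_ /finset.trivIsetP tI _] /forallP c2].
have E : [set i; j]%SET = [set i; partner P i]%SET.
  apply/eqP; apply/negPn/negP => /(tI _ _ ijP piP).
  by rewrite -finset.setI_eq0 => /eqP/finset.setP/(_ i); rewrite !inE eqxx.
have := c2 [set i; j]%SET; rewrite ijP cards2.
move/finset.setP/(_ (partner P i)): E; rewrite !inE eqxx orbT (negbTE pi)/=.
by move=> /eqP.
Qed.

Lemma partnerK P : P \in pairings n -> involutive (partner P).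
Proof.
move=> PP j; apply: partner_eq => //.
by rewrite finset.setUC; case: (partnerP j PP).
Qed.

Lemma mem_pairing P i j : P \in pairings n ->
  ([set i; j]%SET \in P) = (partner P i == j).
Proof.
move=> PP; apply/idP/eqP => [|<-]; first exact: partner_eq.
by case: (partnerP i PP).
Qed.

Lemma partner_inj P P' : P \in pairings n -> P' \in pairings n ->
  partner P =1 partner P' -> P = P'.
Proof.
move=> PP PP' E.
have sub Q Q' : Q \in pairings n -> Q' \in pairings n ->
    partner Q =1 partner Q' -> Q \subset Q'.
  move=> QQ QQ' e; apply/fintype.subsetP => B BQ.
  have := QQ; rewrite inE => /andP[_ /forallP/(_ B)]; rewrite BQ.
  move=> /cards2P[a [b [_ BE]]]; rewrite BE mem_pairing// -e.
  by rewrite -mem_pairing// -BE.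
by apply/eqP; rewrite finset.eqEsubset !sub// => x; rewrite E.
Qed.

Definition closers P : {set 'I_n} := [set j | (partner P j < j)%N].

Lemma notin_closers P j : P \in pairings n ->
  (j \notin closers P) = (j < partner P j)%N.
Proof.
move=> PP; rewrite inE -leqNgt leq_eqVlt; case: eqP => //= E.
by have [/eqP[]] := partnerP j PP; apply/val_inj.
Qed.

Lemma partner_closers P j : P \in pairings n ->
  (partner P j \in closers P) = (j \notin closers P).
Proof. by move=> PP; rewrite notin_closers// inE partnerK. Qed.

Definition pair_set P : {set 'I_n * 'I_n} :=
  [set p : 'I_n * 'I_n | (p.1 < p.2)%N && ([set p.1; p.2]%SET \in P)]%SET.

(** Every point is the left or the right endpoint of exactly one block, so the factors at right
    endpoints and those at left endpoints are both indexed by the blocks. *)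
Lemma prod_pair_set (R : comPzRingType) P (a : 'I_n -> R) :
  P \in pairings n ->
  \prod_(p in pair_set P) (a p.1 * a p.2) = \prod_j a j.
Proof.
move=> PP; rewrite big_split/= (bigID (mem (closers P)))/= mulrC.
congr (_ * _).
  rewrite (reindex_onto (fun j => (partner P j, j)) snd)/=.
    by apply: eq_bigl => j; rewrite !inE/= mem_pairing// partnerK// !eqxx !andbT.
  move=> [i j]; rewrite inE/= mem_pairing// => /andP[_ /eqP<-].
  by rewrite partnerK.
rewrite (reindex_onto (fun j => (j, partner P j)) fst)/=.
  by apply: eq_bigl => j; rewrite inE/= mem_pairing// !eqxx !andbT notin_closers.
by move=> [i j]; rewrite inE/= mem_pairing// => /andP[_ /eqP->].
Qed.

(** A map on the points amounts to a choice of two values per block, so the sum over maps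
    distributes over the product. [j0] fills the values off the blocks. *)
Lemma sum_prod_pair_set (R : comPzRingType) (J : finType) (j0 : J) P
    (F : 'I_n * 'I_n -> J -> J -> R) :
  P \in pairings n ->
  \sum_(f : {ffun 'I_n -> J}) \prod_(p in pair_set P) F p (f p.1) (f p.2) =
  \prod_(p in pair_set P) \sum_(ab : J * J) F p ab.1 ab.2.
Proof.
move=> PP; rewrite (big_distr_big_dep (j0, j0))/=.
pose h (f : {ffun 'I_n -> J}) : {ffun 'I_n * 'I_n -> J * J} :=
  [ffun p : 'I_n * 'I_n => if p \in pair_set P then (f p.1, f p.2) else (j0, j0)].
pose h' (g : {ffun 'I_n * 'I_n -> J * J}) : {ffun 'I_n -> J} :=
  [ffun j : 'I_n => if (j < partner P j)%N then (g (j, partner P j)).1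
             else (g (partner P j, j)).2].
rewrite (reindex_onto h h')/=; last first.
  move=> g /pfamilyP[/supportP gs _]; apply/ffunP => -[i j]; rewrite ffunE/=.
  case: ifPn => [|/gs->//]; rewrite inE/= mem_pairing// => /andP[ij /eqP pi].
  rewrite !ffunE/= pi ij -pi partnerK// ltnNge.
  by rewrite pi (ltnW ij) -surjective_pairing.
apply: esym; apply: eq_big => [f|f _]; last first.
  by apply: eq_bigr => p pP; rewrite ffunE pP.
apply/andP; split.
  apply/pfamilyP; split => //; apply/supportP => p /negbTE pP.
  by rewrite ffunE pP.
apply/eqP/ffunP => j; rewrite !ffunE.
have [jp|pj] := ltnP j (partner P j).
  by rewrite inE/= mem_pairing// jp eqxx.
rewrite inE/= mem_pairing// partnerK// eqxx andbT.
case: ltngtP pj => // /val_inj E.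
by have [/eqP[]] := partnerP j PP.
Qed.

End Pairings.

(** * Counting pairings by their crossings *)

Section PairingCount.
Context {n : nat}.
Implicit Types (P : {set {set 'I_n}}) (i j x y : 'I_n).

(* For a right endpoint y, the crossings in which y is the smaller of the two
   right endpoints. *)
Definition skipped P y : {set 'I_n} :=
  [set x : 'I_n | [&& partner P y < x, x < y & y < partner P x]%N]%SET.

Lemma doubleton_eq (a b c d : 'I_n) : [set a; b]%SET = [set c; d]%SET ->
  (a = c /\ b = d) \/ (a = d /\ b = c).
Proof.
move=> E.
move/finset.setP: E => E; have := E a; have := E b; have := E c; have := E d.
rewrite !finset.in_set2 !eqxx ?orbT/=.
move=> /orP Ed /orP Ec /esym/orP Eb /esym/orP Ea.
by case: Ea => /eqP Ea; case: Eb => /eqP Eb; case: Ec => /eqP Ec;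
  case: Ed => /eqP Ed; (left; split; congruence) || (right; split; congruence).
Qed.

(** A right endpoint [y] and a point [x] skipped by it yield the crossing formed by their two
    blocks; [y] and [x] are recovered from it as its smaller right endpoint and its larger left
    endpoint. *)
Lemma leq_card_crossings P : P \in pairings n ->
  (\sum_y #|skipped P y| <= #|crossings P|)%N.
Proof.
move=> PP; pose D := [set p : 'I_n * 'I_n | p.2 \in skipped P p.1]%SET.
have -> : (\sum_y #|skipped P y| = #|D|)%N.
  rewrite -sum1_card; under eq_bigr do rewrite -sum1_card.
  by rewrite pair_big_dep/=; apply: eq_bigl => p; rewrite !inE.
pose g (p : 'I_n * 'I_n) :=
  [set [set partner P p.1; p.1]; [set p.2; partner P p.2]]%SET.
have g_inj : {in D &, injective g}.
  move=> [y x] [y' x']; rewrite !inE/= => /and3P[h1 h2 h3] /and3P[k1 k2 k3] E.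
  move/finset.setP: E => E.
  have := E [set partner P y; y]%SET; have := E [set x; partner P x]%SET.
  rewrite !finset.in_set2 !eqxx ?orbT/= => /esym/orP A /esym/orP B.
  have toN (a b : 'I_n) : a = b -> (a = b :> nat) by move=> ->.
  by case: A => /eqP/doubleton_eq[] [a1 a2];
    case: B => /eqP/doubleton_eq[] [b1 b2];
    have a1' := toN _ _ a1; have a2' := toN _ _ a2;
    have b1' := toN _ _ b1; have b2' := toN _ _ b2; try lia;
    congr (_, _); apply: val_inj => /=; lia.
rewrite -(card_in_imset g_inj); apply: subset_leq_card.
apply/fintype.subsetP => _ /imsetP[[y x] + ->]; rewrite !inE/= => /and3P[h1 h2 h3].
rewrite /g/=; apply/existsP; exists (partner P y); apply/existsP; exists x.
apply/existsP; exists y; apply/existsP; exists (partner P x).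
by rewrite h1 h2 h3 !mem_pairing// partnerK// !eqxx.
Qed.

(** Call [x < y] open when its partner is not below [y]; both pairings have the same open points. If
    the partner of [y] in [P] were further to the left, [skipped P y] would contain [skipped P' y]
    and, in addition, [partner P' y], against the equal cardinalities. *)
Lemma leq_partner P P' y : P \in pairings n -> P' \in pairings n ->
  (forall x, x < y -> (partner P x < y) = (partner P' x < y))%N ->
  #|skipped P y| = #|skipped P' y| -> (partner P' y < y)%N ->
  (partner P' y <= partner P y)%N.
Proof.
move=> PP PP' E C y'y; rewrite leqNgt; apply/negP => lt.
suff : (#|skipped P' y| < #|skipped P y|)%N by rewrite C ltnn.
have open x : (x < y)%N -> (y < partner P' x)%N -> (partner P x < y)%N = false.
  by move=> xy h; rewrite E// ltnNge (ltnW h).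
have open' x : (partner P y < x)%N -> (x < y)%N ->
    (partner P x < y)%N = false -> (y < partner P x)%N.
  move=> ax xy; case: ltngtP => // /val_inj H.
  by move: ax; rewrite -H partnerK// ltnn.
apply: proper_card; apply/fintype.properP; split.
  apply/fintype.subsetP => x; rewrite !inE => /and3P[h1 h2 h3].
  by rewrite h2 (ltn_trans lt h1) open'// ?open// (ltn_trans lt h1).
exists (partner P' y); rewrite !inE ?ltnn// lt y'y open'//.
by rewrite E// partnerK// ltnn.
Qed.

(** [None] marks a left endpoint. [inord] loses nothing, since at most [n] points are skipped. *)
Definition pairing_code P : {ffun 'I_n -> option 'I_n.+1} :=
  [ffun y => if y \in closers P then Some (inord #|skipped P y|) else None].

(* Scanning from left to right, a closer must be matched with the unique open
   element having the prescribed number of open elements after it. *)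
Lemma pairing_code_inj : {in pairings n &, injective pairing_code}.
Proof.
move=> P P' PP PP' E.
have Ecl y : (y \in closers P) = (y \in closers P').
  by move/ffunP/(_ y): E; rewrite !ffunE; case: ifP; case: ifP.
have Esk y : y \in closers P -> #|skipped P y| = #|skipped P' y|.
  move=> yP; move/ffunP/(_ y): E; rewrite !ffunE -Ecl yP => -[].
  have le Q : (#|skipped Q y| < n.+1)%N.
    by rewrite ltnS -[X in (_ <= X)%N]card_ord max_card.
  by move=> /(congr1 val); rewrite /= !inordK.
have main m y : (y < m)%N -> y \in closers P -> partner P y = partner P' y.
  elim: m y => // m IH y ym yP.
  (* Of two matched points left of [y] one is a right endpoint, so agreement of the partners at
     right endpoints left of [y] extends to all points matched left of [y]. *)
  have aux Q Q' : Q \in pairings n -> Q' \in pairings n ->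
      (forall z, z \in closers Q -> (z < y)%N -> partner Q z = partner Q' z) ->
      forall x, (x < y)%N -> (partner Q x < y)%N -> partner Q' x = partner Q x.
    move=> QQ QQ' h x xy qxy; have [xQ|] := boolP (x \in closers Q).
      by rewrite h.
    rewrite -partner_closers// => /h/(_ qxy); rewrite partnerK// => /esym.
    by move=> hx; rewrite -[in LHS]hx partnerK.
  have Ex x : (x < y)%N -> (partner P x < y)%N = (partner P' x < y)%N.
    move=> xy; apply/idP/idP => h.
      rewrite (aux P P')// => z zP zy; apply: IH => //.
      exact: leq_trans zy _.
    rewrite (aux P' P)// => z; rewrite -Ecl => zP zy; apply/esym; apply: IH => //.
    exact: leq_trans zy _.
  apply: val_inj; apply/eqP; rewrite eqn_leq.
  have yP' : y \in closers P' by rewrite -Ecl.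
  rewrite !leq_partner ?Esk//.
  - by rewrite inE in yP'.
  - by move=> x xy; rewrite Ex.
  - by rewrite inE in yP.
apply: partner_inj => // x; have [xP|] := boolP (x \in closers P).
  exact: (main n).
rewrite -partner_closers// => /(main n _ (ltn_ord _)).
by rewrite partnerK// => h; rewrite {2}h partnerK.
Qed.

(** Once crossings are replaced by skipped points, the weight of a pairing factors over its code: 1
    at a left endpoint, (1-p) p^k at a right endpoint skipping k points. The weights at one point
    sum to at most 2 by the geometric series, and the n/2 right endpoints produce sqrt(1-p)^n. *)
Lemma sum_crossings_le (R : rcfType) (p : R) : 0 <= p < 1 ->
  Num.sqrt (1 - p) ^+ n * (\sum_(P in pairings n) p ^+ #|crossings P|) <= 2 ^+ n.
Proof.
move=> /andP[p0 p1].
have s0 : 0 <= 1 - p by rewrite subr_ge0 ltW.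
pose w (c : option 'I_n.+1) : R := if c is Some k then (1 - p) * p ^+ k else 1.
have w0 c : 0 <= w c by case: c => //= k; rewrite mulr_ge0 ?exprn_ge0.
have sum_w : \sum_c w c <= 2.
  rewrite (bigD1 None)//= (reindex_onto Some (odflt ord0))/=; last by case.
  rewrite (eq_bigl predT) => [|k]; last by rewrite eqxx.
  rewrite -mulr_sumr -opprB mulNr -subrX1 opprB.
  by rewrite -[leRHS]/(1 + 1) lerD2l gerBl exprn_ge0.
apply: le_trans (_ : \sum_(f : {ffun 'I_n -> option 'I_n.+1}) \prod_y w (f y) <= _);
  last first.
  rewrite -(bigA_distr_bigA (fun=> w)) prodr_const card_ord.
  by rewrite lerXn2r ?nnegrE ?sumr_ge0.
apply: le_trans (_ : \sum_(P in pairings n) \prod_y w (pairing_code P y) <= _).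
  rewrite mulr_sumr; apply: ler_sum => P PP.
  have -> : \prod_y w (pairing_code P y) =
      Num.sqrt (1 - p) ^+ n * p ^+ (\sum_y #|skipped P y|).
    (* A block has one right endpoint, so over each block [a] multiplies to 1-p, like the constant
       sqrt(1-p). *)
    pose a y : R := if y \in closers P then 1 - p else 1.
    have -> : Num.sqrt (1 - p) ^+ n = \prod_y a y.
      rewrite -[X in _ ^+ X]card_ord -prodr_const.
      rewrite -(prod_pair_set _ PP) -(prod_pair_set a PP).
      apply: eq_bigr => -[i j]; rewrite /a/= !inE/= mem_pairing//.
      move=> /andP[ij /eqP pi]; rewrite pi -pi partnerK// pi ij.
      by rewrite ltnNge (ltnW ij) mul1r -expr2 sqr_sqrtr.
    rewrite -prodrXr -big_split; apply: eq_bigr => y _.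
    rewrite ffunE /a /=; case: ifP => [yP|yP] /=.
      rewrite inordK// ltnS -[X in (_ <= X)%N]card_ord; exact: max_card.
    have -> : skipped P y = finset.set0.
      apply/finset.setP => x; rewrite !inE; move: yP; rewrite inE; lia.
    by rewrite cards0 expr0 mulr1.
  rewrite ler_wpM2l ?exprn_ge0 ?sqrtr_ge0//.
  by rewrite ler_wiXn2l ?leq_card_crossings// ltW.
rewrite -(big_imset (fun f : {ffun 'I_n -> option 'I_n.+1} => \prod_y w (f y)) pairing_code_inj)/=.
rewrite [leRHS](bigID (mem (imset pairing_code (mem (pairings n)))))/=.
by rewrite lerDl sumr_ge0// => f _; rewrite prodr_ge0.
Qed.

End PairingCount.

(** * Joint q-moments of increments *)

Section Moments.
Context {R : realType} {k : nat}.
Implicit Types (q : R) (t : nat -> R).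

Lemma le_times t (t_lt : forall i, (i < k)%N -> t i < t i.+1) i j :
  (i <= j <= k)%N -> t i <= t j.
Proof.
elim: j => [|j IH] /andP[]; first by rewrite leqn0 => /eqP->.
rewrite leq_eqVlt => /orP[/eqP->//|ij jk].
by rewrite (le_trans (IH _)) ?(ltW (t_lt _ _))// -ltnS ij ltnW.
Qed.

(** Covariance of two increments of a process with covariance min(s,t). A boolean picks an end of
    the interval: [true] the right end with sign 1, [false] the left end with sign -1. *)
Lemma sum_increments_min t (t_lt : forall i, (i < k)%N -> t i < t i.+1)
    (i j : 'I_k) :
  \sum_(ab : bool * bool) (-1) ^+ (~~ ab.1) * (-1) ^+ (~~ ab.2) *
    Num.min (t (i + ab.1)%N) (t (j + ab.2)%N) =
  (if i == j then t i.+1 - t i else 0) :> R.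
Proof.
rewrite -(pair_big xpredT xpredT (fun a b : bool => (-1) ^+ (~~ a) *
  (-1) ^+ (~~ b) * Num.min (t (i + a)%N) (t (j + b)%N)))/= !big_bool/=.
rewrite !addn0 !addn1 !expr0 !expr1 !mul1r !mulr1 !mulrN1 opprK mul1r !mulN1r.
have := ltn_ord i; have := ltn_ord j.
case: (ltngtP i j) => [ij|ji|/val_inj->] jk ik; last first.
- by rewrite eqxx !minxx min_r ?min_l ?(ltW (t_lt _ _))//; ring.
- rewrite -val_eqE/= gtn_eqF//= !min_r;
    first (by ring); by apply: (le_times t_lt); lia.
- rewrite -val_eqE/= ltn_eqF//= !min_l;
    first (by ring); by apply: (le_times t_lt); lia.
Qed.

(** The left side is the multilinear expansion of a moment of increments. For a fixed pairing the
    signed sum splits into one covariance of increments per block. *)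
Lemma q_moment_increments q t (t_lt : forall i, (i < k)%N -> t i < t i.+1)
    n (f : 'I_n -> 'I_k) :
  \sum_(b : {ffun 'I_n -> bool}) (\prod_j (-1) ^+ (~~ b j)) *
    q_moment q (fun j => t (f j + b j)%N) =
  \sum_(P in pairings n) q ^+ #|crossings P| * \prod_(p in pair_set P)
    (if f p.1 == f p.2 then t (f p.1).+1 - t (f p.1) else 0).
Proof.
under eq_bigr do rewrite /q_moment mulr_sumr.
rewrite exchange_big; apply: eq_bigr => P PP /=.
rewrite -(eq_bigr _ (fun p _ => sum_increments_min t_lt (f p.1) (f p.2))).
rewrite -(sum_prod_pair_set true (fun p a b => (-1) ^+ (~~ a) * (-1) ^+ (~~ b) *
  Num.min (t (f p.1 + a)%N) (t (f p.2 + b)%N)) PP) mulr_sumr.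
apply: eq_bigr => b _; rewrite mulrCA big_split/=; congr (_ * (_ * _)).
  by rewrite (prod_pair_set (fun j => (-1) ^+ (~~ b j)) PP).
by apply: eq_bigl => p; rewrite inE.
Qed.

(** With the pairing fixed, the sum over index words factors over the blocks, each contributing the
    sum of the v_i^2 d_i; the n/2 blocks give its square root to the power n. What remains is the
    crossing count [sum_crossings_le]. *)
Lemma sum_moments_le q (q1 : `|q| < 1) (k0 : 'I_k) (v d : 'I_k -> R)
    (v0 : forall i, 0 <= v i) (d0 : forall i, 0 <= d i) n :
  \sum_(f : {ffun 'I_n -> 'I_k}) (\prod_j v (f j)) *
    `|\sum_(P in pairings n) q ^+ #|crossings P| * \prod_(p in pair_set P)
      (if f p.1 == f p.2 then d (f p.1) else 0)| <=
  (2 / Num.sqrt (1 - `|q|) * Num.sqrt (\sum_i v i ^+ 2 * d i)) ^+ n.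
Proof.
pose c (i j : 'I_k) := if i == j then d i else 0.
have c0 i j : 0 <= c i j by rewrite /c; case: ifP.
pose s := Num.sqrt (1 - `|q|).
have s0 : 0 < s by rewrite sqrtr_gt0 subr_gt0.
pose V := \sum_i v i ^+ 2 * d i; rewrite -/s -/V.
apply: (@le_trans _ _
    (Num.sqrt V ^+ n * \sum_(P in pairings n) `|q| ^+ #|crossings P|)).
  apply: (@le_trans _ _ (\sum_(f : {ffun 'I_n -> 'I_k})
      \sum_(P in pairings n) `|q| ^+ #|crossings P| *
      \prod_(p in pair_set P) (v (f p.1) * v (f p.2) * c (f p.1) (f p.2)))).
    apply: ler_sum => f _; rewrite [leRHS](_ : _ = (\prod_j v (f j)) *
      \sum_(P in pairings n) `|q| ^+ #|crossings P| *
        \prod_(p in pair_set P) c (f p.1) (f p.2)); last first.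
      rewrite mulr_sumr; apply: eq_bigr => P PP.
      by rewrite big_split/= (prod_pair_set (v \o f) PP) mulrCA.
    rewrite ler_wpM2l ?prodr_ge0//; apply: le_trans (ler_norm_sum _ _ _) _.
    apply: ler_sum => P _; rewrite normrM normrX ler_wpM2l ?exprn_ge0//.
    by rewrite ger0_norm//; apply: prodr_ge0 => p _; exact: c0.
  rewrite exchange_big/= mulr_sumr; apply: ler_sum => P PP.
  rewrite -mulr_sumr mulrC ler_wpM2r ?exprn_ge0//.
  rewrite (sum_prod_pair_set k0 (fun _ a b => v a * v b * c a b) PP).
  rewrite -[X in _ ^+ X]card_ord -prodr_const -(prod_pair_set _ PP).
  rewrite le_eqVlt; apply/orP; left; apply/eqP; apply: eq_bigr => p _.
  rewrite -expr2 sqr_sqrtr ?sumr_ge0// => [|i _]; last first.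
    by rewrite mulr_ge0 ?exprn_ge0.
  rewrite -(pair_big xpredT xpredT (fun a b => v a * v b * c a b))/=.
  apply: eq_bigr => i _; rewrite (bigD1 i)//= big1 ?addr0 => [|j ji].
    by rewrite /c eqxx expr2.
  by rewrite /c eq_sym (negbTE ji) mulr0.
rewrite exprMn mulrC ler_wpM2r ?exprn_ge0 ?sqrtr_ge0//.
rewrite expr_div_n ler_pdivlMr ?exprn_gt0// mulrC.
by rewrite sum_crossings_le// q1 normr_ge0.
Qed.

End Moments.

Local Open Scope complex_scope.

(** * Bounded operators on a Hilbert space *)

Section HilbertNorm.
Context {R : realType} {H : hilbertType R}.
Implicit Types (x y z : H) (a : R[i]).

(* The norm of a Hilbert space is valued in R[i]. *)
Definition hnorm x : R := complex.Re `|x|.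
Definition cabs a : R := complex.Re `|a|.

Lemma hnormE x : (hnorm x)%:C = `|x|.
Proof. by rewrite RRe_real// normr_real. Qed.

Lemma cabsE a : (cabs a)%:C = `|a|.
Proof. by rewrite RRe_real// normr_real. Qed.

Lemma cabs_ge0 a : 0 <= cabs a.
Proof. by rewrite -ler0c cabsE. Qed.

Lemma hnorm_ge0 x : 0 <= hnorm x.
Proof. by rewrite -ler0c hnormE. Qed.

Lemma hnorm0 : hnorm 0 = 0.
Proof. by apply/complexI; rewrite hnormE normr0. Qed.

Lemma hnorm_eq0 x : (hnorm x == 0) = (x == 0).
Proof. by rewrite -(inj_eq (@complexI _)) hnormE normr_eq0. Qed.

Lemma hnormD x y : hnorm (x + y) <= hnorm x + hnorm y.
Proof. by rewrite -lecR rmorphD/= !hnormE ler_normD. Qed.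

Lemma hnormN x : hnorm (- x) = hnorm x.
Proof. by rewrite /hnorm normrN. Qed.

Lemma hnormB x y : hnorm (x - y) <= hnorm x + hnorm y.
Proof. by rewrite -(hnormN y) hnormD. Qed.

Lemma hnorm_distC x y : hnorm (x - y) = hnorm (y - x).
Proof. by rewrite -hnormN opprB. Qed.

Lemma hnormZ a x : hnorm (a *: x) = cabs a * hnorm x.
Proof. by apply/complexI; rewrite rmorphM/= !hnormE cabsE normrZ. Qed.

Lemma cabsM a b : cabs (a * b) = cabs a * cabs b.
Proof. by apply/complexI; rewrite rmorphM/= !cabsE normrM. Qed.

Lemma cabsD a b : cabs (a + b) <= cabs a + cabs b.
Proof. by rewrite -lecR rmorphD/= !cabsE ler_normD. Qed.

Lemma cabsN a : cabs (- a) = cabs a.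
Proof. by rewrite /cabs normrN. Qed.

Lemma cabs_sum (I : Type) (r : seq I) (P : pred I) (F : I -> R[i]) :
  cabs (\sum_(i <- r | P i) F i) <= \sum_(i <- r | P i) cabs (F i).
Proof.
elim/big_ind2: _ => [|u u' v v' h h'|//]; first by rewrite /cabs normr0.
by rewrite (le_trans (cabsD _ _))// lerD.
Qed.

Lemma cabs_real (t : R) : cabs t%:C = `|t|.
Proof. by rewrite /cabs normc_def/= expr0n addr0 sqrtr_sqr. Qed.

Lemma cabs_conj a : cabs (conjc a) = cabs a.
Proof. by rewrite /cabs normcJ. Qed.

Lemma cabs_eq0 a : (cabs a == 0) = (a == 0).
Proof. by rewrite -(inj_eq (@complexI _)) cabsE normr_eq0. Qed.

Lemma inner_hnorm x : inner x x = (hnorm x ^+ 2)%:C.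
Proof. by rewrite inner_norm rmorphXn/= hnormE. Qed.

Lemma conjcM a b : conjc (a * b) = conjc a * conjc b.
Proof. exact: rmorphM. Qed.

Lemma conjcD a b : conjc (a + b) = conjc a + conjc b.
Proof. exact: rmorphD. Qed.

(* [innerZr] restated with [conjc] instead of [Num.conj]. *)
Lemma innerZconj a x y : inner x (a *: y) = conjc a * inner x y.
Proof. exact: innerZr. Qed.

Lemma innerNl x y : inner (- x) y = - inner x y.
Proof. by rewrite -scaleN1r innerZl mulN1r. Qed.

Lemma innerNr x y : inner x (- y) = - inner x y.
Proof. by rewrite innerC innerNl rmorphN/= -innerC. Qed.

Lemma innerBl x y z : inner (x - y) z = inner x z - inner y z.
Proof. by rewrite innerDl innerNl. Qed.

Lemma innerBr x y z : inner x (y - z) = inner x y - inner x z.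
Proof. by rewrite innerDr innerNr. Qed.

(** Cauchy-Schwarz: the residual of [x] after projection on [y] has a nonnegative square norm. *)
Lemma inner_le x y : cabs (inner x y) <= hnorm x * hnorm y.
Proof.
have [->|y0] := eqVneq y 0.
  by rewrite inner0r hnorm0 mulr0 (_ : cabs 0 = 0)// /cabs normr0.
have Y0 : 0 < hnorm y by rewrite lt_def hnorm_ge0 hnorm_eq0 y0.
pose t := (hnorm y ^+ 2)^-1.
rewrite -(@ler_pXn2r _ 2) ?nnegrE ?cabs_ge0 ?mulr_ge0 ?hnorm_ge0// exprMn.
set a := inner x y.
have : 0 <= inner (x - (a * t%:C) *: y) (x - (a * t%:C) *: y).
  exact: inner_ge0.
have -> : inner (x - (a * t%:C) *: y) (x - (a * t%:C) *: y) =
    (hnorm x ^+ 2 - cabs a ^+ 2 / hnorm y ^+ 2)%:C.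
  have aa : a * conjc a = (cabs a ^+ 2)%:C by rewrite -sqr_normc rmorphXn/= cabsE.
  have ac : conjc (a * t%:C) = conjc a * t%:C.
    by rewrite conjcM conjc_real.
  have tt : t%:C * (hnorm y ^+ 2)%:C = 1 :> R[i].
    by rewrite -(rmorphM (real_complex R)) mulVf// gt_eqF// exprn_gt0.
  rewrite innerBl !innerBr !innerZl !innerZconj !inner_hnorm.
  rewrite (innerC y x) -/a ac -/t.
  have -> : (hnorm x ^+ 2 - cabs a ^+ 2 * t)%:C =
      (hnorm x ^+ 2)%:C - (cabs a ^+ 2)%:C * t%:C.
    by rewrite -rmorphM -rmorphB.
  rewrite -aa.
  by rewrite -(mulrA _ t%:C (hnorm y ^+ 2)%:C) tt; ring.
by rewrite ler0c subr_ge0 ler_pdivrMr ?exprn_gt0.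
Qed.

Lemma inner_eq0 x : (forall y, inner x y = 0) -> x = 0.
Proof.
move=> /(_ x); rewrite inner_hnorm => /complexI/eqP.
by rewrite expf_eq0/= hnorm_eq0 => /eqP.
Qed.

End HilbertNorm.

(** * Operator bounds, norm limits and the square-root iteration *)

Section OperatorBound.
Context {R : realType} {H : hilbertType R}.
Implicit Types (S T U : bop H) (x y z : H) (a : R[i]) (c d e : R).

Lemma bop_subE S T x : (S - T) x = S x - T x.
Proof. by rewrite bop_addE bop_oppE. Qed.

Lemma bop_scaleAl a S T : (a *: S) * T = a *: (S * T).
Proof. exact: bopP. Qed.

Lemma bop_scaleAr a S T : S * (a *: T) = a *: (S * T).
Proof. by apply: bopP => x; rewrite bop_mulE !bop_scaleE linearZ. Qed.

(** Bounds are carried by this predicate, which adds and multiplies directly, rather than by the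
    supremum [opnorm]; [opbd_opnorm] and [opnorm_le] translate. *)
Definition opbd T c := forall x, hnorm (T x) <= c * hnorm x.

Lemma opbd_ex T : exists2 c, 0 < c & opbd T c.
Proof.
have [M M0 h] := bop_bounded_ge0 T; exists (M + 1); first by rewrite ltr_wpDl.
move=> x; rewrite mulrDl mul1r ler_wpDr ?hnorm_ge0//.
by rewrite -lecR rmorphM/= !hnormE.
Qed.

Lemma opbd_le T c d : c <= d -> opbd T c -> opbd T d.
Proof. by move=> cd h x; rewrite (le_trans (h x))// ler_wpM2r ?hnorm_ge0. Qed.

Lemma opbdD S T c d : opbd S c -> opbd T d -> opbd (S + T) (c + d).
Proof. by move=> h k x; rewrite mulrDl (le_trans (hnormD _ _))// lerD. Qed.

Lemma opbdZ a T c : opbd T c -> opbd (a *: T) (cabs a * c).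
Proof.
by move=> h x; rewrite hnormZ -mulrA ler_wpM2l ?cabs_ge0.
Qed.

Lemma opbdN T c : opbd T c -> opbd (- T) c.
Proof. by move=> h x; rewrite bop_oppE hnormN. Qed.

Lemma opbdB S T c d : opbd S c -> opbd T d -> opbd (S - T) (c + d).
Proof. by move=> h k; apply: opbdD => //; exact: opbdN. Qed.

Lemma opbd_distC S T c : opbd (S - T) c -> opbd (T - S) c.
Proof. by move=> h; rewrite -opprB; exact: opbdN. Qed.

Lemma opbd1 : opbd 1 1. Proof. by move=> x; rewrite mul1r. Qed.

Lemma opbd0 : opbd 0 0. Proof. by move=> x; rewrite mul0r hnorm0. Qed.

Lemma opbdM S T c d : 0 <= c -> opbd S c -> opbd T d -> opbd (S * T) (c * d).
Proof.
by move=> c0 h k x; rewrite -mulrA (le_trans (h _))// ler_wpM2l.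
Qed.

Lemma ler_eps (s t k : R) : (forall e, 0 < e -> s <= t + e * k) -> s <= t.
Proof.
move=> h; apply/ler_addgt0Pr => e e0.
have k0 : 0 < `|k| + 1 by rewrite ltr_wpDl.
apply: (le_trans (h (e / (`|k| + 1)) (divr_gt0 e0 k0))); rewrite lerD2l.
rewrite mulrAC ler_pdivrMr// ler_pM2l//.
by rewrite (le_trans (ler_norm _))// lerDl.
Qed.

Lemma opbd_eps T c : (forall e, 0 < e -> opbd T (c + e)) -> opbd T c.
Proof.
by move=> h x; apply: (@ler_eps _ _ (hnorm x)) => e e0; rewrite -mulrDl; exact: h.
Qed.

Lemma opbd0_eq T : opbd T 0 -> T = 0.
Proof.
move=> h; apply: bopP => x; apply/eqP; rewrite -hnorm_eq0 eq_le hnorm_ge0.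
by have := h x; rewrite mul0r => ->.
Qed.

Lemma bop_eq_inner S T : (forall x y, inner (S x) y = inner (T x) y) -> S = T.
Proof.
move=> h; apply: bopP => x; apply/eqP; rewrite -subr_eq0; apply/eqP.
by apply: inner_eq0 => y; rewrite innerBl h subrr.
Qed.

Lemma has_sup_opnorm T :
  has_sup [set complex.Re `|T x| | x in [set x : H | `|x| <= 1]]%classic.
Proof.
have [c c0 hc] := opbd_ex T.
split; first by exists (hnorm (T 0)), 0 => //=; rewrite normr0.
exists c => _ [x /= x1 <-]; rewrite (le_trans (hc x))// ger_pMr//.
by rewrite -lecR hnormE.
Qed.

Lemma opbd_opnorm T : opbd T (opnorm T).
Proof.
move=> x; have [->|x0] := eqVneq x 0; first by rewrite linear0 !hnorm0 mulr0.
have X0 : 0 < hnorm x by rewrite lt_def hnorm_ge0 hnorm_eq0 x0.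
rewrite -ler_pdivrMr//; apply: (sup_upper_bound (has_sup_opnorm T)).
exists ((hnorm x)^-1%:C *: x) => /=.
  rewrite -hnormE hnormZ cabs_real ger0_norm ?invr_ge0 ?hnorm_ge0//.
  by rewrite mulVf// gt_eqF.
rewrite linearZ -/(hnorm _) hnormZ cabs_real ger0_norm ?invr_ge0 ?hnorm_ge0//.
by rewrite mulrC.
Qed.

Lemma opnorm_le T c : 0 <= c -> opbd T c -> opnorm T <= c.
Proof.
move=> c0 h; apply: ge_sup; first by exists (hnorm (T 0)), 0 => //=; rewrite normr0.
move=> _ [x /= x1 <-]; rewrite (le_trans (h x))// -[leRHS]mulr1 ler_wpM2l//.
by rewrite -lecR hnormE.
Qed.

Lemma opnorm_ge0 T : 0 <= opnorm T.
Proof.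
apply: (le_trans (hnorm_ge0 (T 0))).
apply: (sup_upper_bound (has_sup_opnorm T)).
by exists 0 => //=; rewrite normr0.
Qed.

Lemma opnorm0 : opnorm (0 : bop H) = 0.
Proof.
by apply/eqP; rewrite eq_le opnorm_ge0 opnorm_le//; exact: opbd0.
Qed.

(** Completeness of the bounded operators: the limit is taken pointwise and keeps the rate [e] of
    the uniform estimate. *)
Lemma bop_lim (T : nat -> bop H) (e : nat -> R) :
  (forall m n, (m <= n)%N -> opbd (T n - T m) (e m)) ->
  (forall d, 0 < d -> exists m, e m <= d) ->
  exists T', forall m, opbd (T' - T m) (e m).
Proof.
move=> hT he.
have lim x : exists l, forall m, hnorm (l - T m x) <= e m * hnorm x.
  have : cvg ((fun n => T n x) @ \oo)%classic.
    apply: cauchy_cvg; apply: cauchy_exP => d d0.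
    have dE : d = (complex.Re d)%:C by rewrite RRe_real// gtr0_real.
    have d0' : 0 < complex.Re d by rewrite -ltcR -dE.
    have x1 : 0 < hnorm x + 1 by rewrite ltr_wpDl ?hnorm_ge0.
    have [m hm] := he _ (divr_gt0 d0' x1).
    exists (T m x), m => // n /= mn; rewrite -ball_normE/= dE -hnormE ltcR.
    rewrite hnorm_distC -bop_subE (le_lt_trans (hT _ _ mn x))//.
    apply: (@le_lt_trans _ _ (complex.Re d / (hnorm x + 1) * hnorm x)).
      by rewrite ler_wpM2r ?hnorm_ge0.
    by rewrite mulrAC ltr_pdivrMr// ltr_pM2l// ltrDl.
  move=> /cvg_ex[l hl]; exists l => m; apply: (@ler_eps _ _ 1) => d d0.
  have d0' : 0 < d%:C :> R[i] by rewrite ltcR.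
  have := hl _ (nbhsx_ballx l _ d0') => -[n _ /(_ (maxn n m) (leq_maxl _ _))].
  rewrite /= -ball_normE/= -hnormE ltcR => hn.
  rewrite -(subrK (T (maxn n m) x) l) -addrA (le_trans (hnormD _ _))//.
  by rewrite [leRHS]addrC mulr1 lerD ?(ltW hn)// -bop_subE hT// leq_maxr.
have [f hf] := choice lim.
have f_lin : linear f.
  move=> a x y; apply/eqP; rewrite -subr_eq0 -hnorm_eq0 eq_le hnorm_ge0 andbT.
  apply: (@ler_eps _ _ (hnorm (a *: x + y) + (cabs a * hnorm x + hnorm y))).
  move=> d d0; have [m hm] := he _ d0.
  have hm' z : hnorm (f z - T m z) <= d * hnorm z.
    by rewrite (le_trans (hf z m))// ler_wpM2r ?hnorm_ge0.
  have -> : f (a *: x + y) - (a *: f x + f y) =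
      (f (a *: x + y) - T m (a *: x + y)) - (a *: (f x - T m x) + (f y - T m y)).
    rewrite (bop_linear (T m)) scalerBr [X in _ = _ - X]addrACA -opprD opprB addrA.
    by rewrite subrK.
  rewrite add0r mulrDr (le_trans (hnormB _ _))// lerD//.
  rewrite (le_trans (hnormD _ _))// mulrDr lerD// hnormZ mulrCA.
  by rewrite ler_wpM2l ?cabs_ge0.
have f_bnd : exists M : R, forall x, `|f x| <= M%:C * `|x|.
  have [c c0 hc] := opbd_ex (T 0%N); exists (e 0%N + c) => x.
  rewrite -!hnormE -rmorphM lecR -(subrK (T 0%N x) (f x)) mulrDl.
  by rewrite (le_trans (hnormD _ _))// lerD.
by exists (Bop f_lin f_bnd) => m x; rewrite bop_subE; exact: hf.
Qed.

Definition norm_closed (C : set (bop H)) :=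
  forall T, (forall e, 0 < e -> exists2 S, C S & opbd (T - S) e) -> C T.

(* [1 - Y] is a square root of [1 - B]; [Y] is the limit of the iteration
   Y <- (B + Y^2) / 2, dominated by the same scalar iteration with B = 1. *)
Lemma sqrt_fixpoint (B : bop H) (C : set (bop H)) : opbd B 1 ->
  C 0 -> (forall Y, C Y -> C (2^-1 *: (B + Y * Y))) -> norm_closed C ->
  exists Y, [/\ C Y, opbd Y 1 & (1 - Y) * (1 - Y) = 1 - B].
Proof.
move=> B1 C0 CS Ccl.
pose Y := fix Y n := if n is m.+1 then 2^-1 *: (B + Y m * Y m) else 0.
pose y := fix y n : R := if n is m.+1 then (1 + y m ^+ 2) / 2 else 0.
have yS n : y n.+1 = (1 + y n ^+ 2) / 2 by [].
have YS n : Y n.+1 = 2^-1 *: (B + Y n * Y n) by [].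
have c2 : cabs 2^-1 = 2^-1 :> R.
  have -> : 2^-1 = (2^-1 : R)%:C by rewrite fmorphV/= rmorphMn/= rmorph1.
  by rewrite cabs_real ger0_norm ?invr_ge0.
have y01 n : 0 <= y n <= 1 by elim: n => [|n /andP[h k]]; rewrite ?yS//=; nra.
have y_inc n : y n <= y n.+1 by rewrite yS; have := sqr_ge0 (y n - 1); nra.
have CY n : C (Y n) by elim: n => //= n; exact: CS.
have Yy n : opbd (Y n) (y n).
  elim: n => [|n IH]; first exact: opbd0.
  rewrite YS yS mulrC -c2; apply: opbdZ; apply: opbdD => //.
  by rewrite expr2; apply: opbdM => //; case/andP: (y01 n).
(* Difference of squares: S^2 - T^2 = S (S - T) + (S - T) T, bounded by the same identity for
   [y]. *)
have step n : opbd (Y n.+1 - Y n) (y n.+1 - y n).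
  elim: n => [|n IH]; first by rewrite !subr0; exact: (Yy 1%N).
  have -> : Y n.+2 - Y n.+1 =
      2^-1 *: (Y n.+1 * (Y n.+1 - Y n) + (Y n.+1 - Y n) * Y n).
    rewrite YS [X in _ - X = _]YS -scalerBr opprD addrACA subrr add0r.
    by rewrite mulrBr mulrBl addrA subrK.
  have -> : y n.+2 - y n.+1 =
      2^-1 * (y n.+1 * (y n.+1 - y n) + (y n.+1 - y n) * y n).
    by rewrite yS [X in _ - X = _]yS; field.
  rewrite -{1}c2; apply: opbdZ; apply: opbdD; apply: opbdM => //.
    by case/andP: (y01 n.+1).
  by rewrite subr_ge0.
(* Since y_(m+1) - y_m = (1 - y_m)^2 / 2, staying [d] below 1 would add at least d^2 / 2 at every
   step and finally exceed 1. *)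
have y_cvg d : 0 < d -> exists m, 1 - y m <= d.
  move=> d0; apply: contrapT => /forallNP h.
  have {}h m : d <= 1 - y m by rewrite leNgt; apply/negP => /ltW /h.
  have lin m : m%:R * (d ^+ 2 / 2) <= y m.
    elim: m => [|m IH]; first by rewrite mul0r.
    rewrite yS -natr1 mulrDl mul1r.
    by have := h m; have /andP[? ?] := y01 m; nra.
  have d2 : 0 < d ^+ 2 / 2 by rewrite divr_gt0// exprn_gt0.
  have := archi_boundP (ltW (divr_gt0 ltr01 d2)).
  rewrite ltr_pdivrMr// => /lt_le_trans/(_ (lin _)).
  by rewrite ltNge; case/andP: (y01 (Num.Def.archi_bound (1 / (d ^+ 2 / 2)))) => _ ->.
have cauchy m n : (m <= n)%N -> opbd (Y n - Y m) (1 - y m).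
  move=> mn; apply: (@opbd_le _ (y n - y m)).
    by rewrite lerD2r; case/andP: (y01 n).
  elim: n mn => [|n IH]; first by rewrite leqn0 => /eqP->; rewrite !subrr; exact: opbd0.
  rewrite leq_eqVlt => /orP[/eqP->|mn]; first by rewrite !subrr; exact: opbd0.
  rewrite -(subrK (Y n) (Y n.+1)) -(subrK (y n) (y n.+1))
    -(addrA _ (Y n)) -(addrA _ (y n)).
  by apply: opbdD => //; exact: IH.
have [Z hZ] := bop_lim cauchy y_cvg.
have Z1 : opbd Z 1.
  apply: opbd_eps => e e0; have [m hm] := y_cvg _ e0.
  rewrite -(subrK (Y m) Z) addrC [1 + e]addrC.
  rewrite [Y m + _]addrC; apply: opbdD; first exact: opbd_le hm (hZ m).
  by apply: opbd_le (Yy m); case/andP: (y01 m).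
exists Z; split => //.
  apply: Ccl => e e0; have [m hm] := y_cvg _ e0.
  by exists (Y m) => //; exact: opbd_le hm (hZ m).
(* The limit solves 2 Z = B + Z^2, that is, (1 - Z)^2 = 1 - B. *)
have ZE : Z = 2^-1 *: (B + Z * Z).
  apply/eqP; rewrite -subr_eq0; apply/eqP/opbd0_eq/opbd_eps => e e0.
  have e2 : 0 < e / 2 by rewrite divr_gt0.
  have [m hm] := y_cvg _ e2.
  have -> : Z - 2^-1 *: (B + Z * Z) = (Z - Y m.+1) -
      2^-1 *: (Z * (Z - Y m) + (Z - Y m) * Y m).
    rewrite mulrBr mulrBl addrA subrK YS -addrA -opprD -scalerDr -addrA.
    by rewrite [Y m * Y m + _]addrC subrK.
  rewrite add0r (splitr e); apply: opbdB.
    by apply: opbd_le (hZ m.+1); rewrite (le_trans _ hm)// lerD2l lerN2.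
  apply: (@opbd_le _ (2^-1 * (1 * (e / 2) + (e / 2) * 1))); first by rewrite mul1r mulr1; lra.
  rewrite -{1}c2; apply: opbdZ; apply: opbdD; apply: opbdM => //.
  - exact: opbd_le hm (hZ m).
  - exact: ltW.
  - exact: opbd_le hm (hZ m).
  - by apply: opbd_le (Yy m); case/andP: (y01 m).
have ZZ : Z * Z = Z + Z - B.
  have half : 2^-1 + 2^-1 = 1 :> R[i] by field.
  by rewrite {3 4}ZE -scalerDl half scale1r addrC addKr.
by rewrite mulrBl mul1r mulrBr mulr1 opprB ZZ [X in _ + X]addrAC addrK addrA subrK.
Qed.

End OperatorBound.

(** * Positive operators and their square roots *)

Section Positive.
Context {R : realType} {H : hilbertType R}.
Implicit Types (S T U P : bop H) (x y z : H) (a : R[i]) (c d e : R).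

Definition pos_bop P := forall x, 0 <= inner (P x) x.

Lemma opbd_eps0 T c : (forall e, 0 < e -> opbd T (e * c)) -> T = 0.
Proof.
move=> h; apply: opbd0_eq => x; rewrite mul0r.
by apply: (@ler_eps _ _ _ (c * hnorm x)) => e e0; rewrite add0r mulrA; exact: h.
Qed.

Lemma cabs_eps0 a c : (forall e, 0 < e -> cabs a <= e * c) -> a = 0.
Proof.
move=> h; apply/eqP; rewrite -cabs_eq0 eq_le cabs_ge0 andbT.
by apply: (@ler_eps _ _ _ c) => e e0; rewrite add0r; exact: h.
Qed.

Lemma conj_fixE a : conjc a = a -> a = (complex.Re a)%:C.
Proof.
case: a => u v [] /eqP; rewrite eq_sym -addr_eq0 -mulr2n mulrn_eq0/=.
by move=> /eqP->.
Qed.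

(** Polarization: the defect of symmetry [g] vanishes on the diagonal, and its values at x + y and x
    + iy give g x y = 0. *)
Lemma pos_self_adjoint P : pos_bop P -> self_adjoint P.
Proof.
move=> P0; pose g x y := inner (P x) y - inner x (P y).
have gx x : g x x = 0.
  have /ger0_Im := P0 x; rewrite /g [in X in _ - X]innerC.
  by case: (inner (P x) x) => u v /= ->; rewrite oppr0 subrr.
have gD x x' y y' : g (x + x') (y + y') = g x y + g x' y' + (g x y' + g x' y).
  by rewrite /g !linearD !innerDl !innerDr; ring.
move=> x y; apply/eqP; rewrite -subr_eq0 -/(g x y); apply/eqP.
have e1 : g x y + g y x = 0.
  by have := gx (x + y); rewrite gD !gx !add0r.
have e2 : g x y - g y x = 0.
  have := gx (x + 'i *: y); rewrite gD !gx !add0r.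
  have -> : g x ('i *: y) = - 'i * g x y.
    have ci : conjc 'i = - 'i :> R[i] by apply/eqP; rewrite eq_complex/= oppr0 !eqxx.
    by rewrite /g linearZ !innerZconj ci mulrBr.
  have -> : g ('i *: y) x = 'i * g y x.
    by rewrite /g linearZ !innerZl mulrBr.
  rewrite mulNr addrC -mulrBr => /eqP; rewrite mulf_eq0 => /orP[|/eqP].
    by rewrite eq_complex/= oner_eq0 andbF.
  by move=> h; rewrite -opprB h oppr0.
have : 2 * g x y = 0.
  by rewrite -[0]addr0 -{1}e1 -e2; ring.
by move=> /eqP; rewrite mulf_eq0 pnatr_eq0 => /eqP.
Qed.

Lemma pos_Re P x : pos_bop P -> inner (P x) x = (complex.Re (inner (P x) x))%:C.
Proof. by move=> /(_ x)/ger0_real/RRe_real. Qed.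

(** This is P^2 <= c P: expand the positivity of [P] at x - P x / c and use <P P x, P x> <= c |P
    x|^2. *)
Lemma pos_norm_le P c x : pos_bop P -> 0 < c -> opbd P c ->
  hnorm (P x) ^+ 2 <= c * complex.Re (inner (P x) x).
Proof.
move=> P0 c0 Pc; pose y := x - c^-1%:C *: P x.
have := P0 y; have sa := pos_self_adjoint P0.
rewrite /y linearB linearZ/= innerBl !innerBr !innerZl !innerZconj conjc_real.
rewrite [inner (P (P x)) x]sa !inner_hnorm [inner (P x) x]pos_Re//.
have := P0 (P x); rewrite [inner (P (P x)) _]pos_Re// ler0c => ge0.
have le : complex.Re (inner (P (P x)) (P x)) <= c * hnorm (P x) ^+ 2.
  have := inner_le (P (P x)) (P x); rewrite [inner (P (P x)) _]pos_Re//.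
  rewrite cabs_real ger0_norm// => /le_trans; apply.
  by rewrite expr2 mulrA ler_wpM2r ?hnorm_ge0.
rewrite -!(rmorphM, rmorphB)/= ler0c => h.
have k : c^-1 * (c^-1 * complex.Re (inner (P (P x)) (P x))) <=
    c^-1 * hnorm (P x) ^+ 2.
  by rewrite ler_wpM2l ?invr_ge0 ?(ltW c0)// ler_pdivrMl.
have {h k} : c^-1 * hnorm (P x) ^+ 2 <= complex.Re (inner (P x) x) by lra.
by rewrite ler_pdivrMl.
Qed.

Lemma pos_eq0 P x : pos_bop P -> inner (P x) x = 0 -> P x = 0.
Proof.
move=> P0 h; have [c c0 Pc] := opbd_ex P.
have := pos_norm_le x P0 c0 Pc; rewrite h mulr0 => k.
apply/eqP; rewrite -hnorm_eq0.
have : hnorm (P x) ^+ 2 == 0 by rewrite eq_le k exprn_ge0 ?hnorm_ge0.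
by rewrite expf_eq0.
Qed.

Lemma self_adjointB S T : self_adjoint S -> self_adjoint T -> self_adjoint (S - T).
Proof. by move=> h k x y; rewrite !bop_subE innerBl innerBr h k. Qed.

Lemma norm_closed_self_adjoint : norm_closed [set T : bop H | self_adjoint T]%classic.
Proof.
move=> T h x y; apply/eqP; rewrite -subr_eq0; apply/eqP.
apply: (@cabs_eps0 _ (2 * (hnorm x * hnorm y))) => e e0.
have [S /= Ssa ST] := h e e0.
have -> : inner (T x) y - inner x (T y) =
    inner ((T - S) x) y + - inner x ((T - S) y).
  by rewrite !bop_subE innerBl innerBr Ssa; ring.
rewrite (le_trans (cabsD _ _))// cabsN.
rewrite mulrCA mulr_natl mulr2n lerD//.
  by rewrite (le_trans (inner_le _ _))// mulrA ler_wpM2r ?hnorm_ge0.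
by rewrite (le_trans (inner_le _ _))// mulrCA ler_wpM2l ?hnorm_ge0.
Qed.

Lemma norm_closed_comm U : norm_closed [set T : bop H | U * T = T * U]%classic.
Proof.
move=> T h /=; apply/eqP; rewrite -subr_eq0; apply/eqP.
have [c c0 Uc] := opbd_ex U.
apply: (@opbd_eps0 _ (c + c)) => e e0.
have [S /= SU ST] := h e e0.
have -> : U * T - T * U = U * (T - S) - (T - S) * U.
  by rewrite mulrBr mulrBl opprB SU addrA subrK.
rewrite [e * _]mulrDr; apply: opbdB; last by apply: opbdM => //; exact: ltW.
by rewrite [e * c]mulrC; apply: opbdM => //; exact: ltW.
Qed.

(** Structure shared by the von Neumann algebra and the norm closure of the algebraic tensor
    product; positive elements have their square roots in it. *)
Record norm_closed_algebra (C : set (bop H)) : Prop := NormClosedAlgebra {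
  nca_one : C 1;
  nca_lin : forall a S T, C S -> C T -> C (a *: S + T);
  nca_mul : forall S T, C S -> C T -> C (S * T);
  nca_closed : norm_closed C
}.

Section Algebra.
Context {C : set (bop H)} (hC : norm_closed_algebra C).

Lemma nca0 : C 0.
Proof.
have := nca_lin hC (-1) (nca_one hC) (nca_one hC).
by rewrite scaleN1r addNr.
Qed.

Lemma ncaZ a T : C T -> C (a *: T).
Proof. by move=> CT; rewrite -[_ *: _]addr0; apply: (nca_lin hC) => //; exact: nca0. Qed.

Lemma ncaD S T : C S -> C T -> C (S + T).
Proof. by move=> CS CT; rewrite -[S]scale1r; exact: (nca_lin hC). Qed.

Lemma ncaB S T : C S -> C T -> C (S - T).
Proof. by move=> CS CT; apply: ncaD => //; rewrite -scaleN1r; exact: ncaZ. Qed.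

Lemma ncaX n T : C T -> C (T ^+ n).
Proof.
move=> CT; elim: n => [|n IH]; first by rewrite expr0; exact: (nca_one hC).
by rewrite exprS; exact: (nca_mul hC).
Qed.

(** With [c] a bound of [P], the root is sqrt(c) (1 - Y), where (1 - Y)^2 = P / c comes from the
    iteration for B = 1 - P / c. *)
Lemma pos_sqrt P : C P -> pos_bop P -> exists S,
  [/\ C S, pos_bop S, S * S = P & forall U, U * P = P * U -> U * S = S * U].
Proof.
move=> CP P0; have [c c0 Pc] := opbd_ex P.
pose B := 1 - c^-1%:C *: P.
have Psa := pos_self_adjoint P0.
(* |B x|^2 = |x|^2 - 2 <P x, x> / c + |P x|^2 / c^2, and [pos_norm_le] bounds the last term by <P x,
   x> / c. *)
have B1 : opbd B 1.
  move=> x; rewrite mul1r -(@ler_pXn2r _ 2) ?nnegrE ?hnorm_ge0// -lecR.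
  rewrite -inner_hnorm bop_subE bop_scaleE bop_oneE innerBl !innerBr.
  rewrite !innerZl !innerZconj conjc_real -[inner x (P x)]Psa.
  rewrite !inner_hnorm [inner (P x) x]pos_Re//.
  rewrite -!(rmorphM, rmorphB)/= lecR.
  have := P0 x; rewrite [inner (P x) x]pos_Re// ler0c => h.
  have := pos_norm_le x P0 c0 Pc; rewrite -ler_pdivrMl// => k.
  have : c^-1 * (c^-1 * hnorm (P x) ^+ 2) <=
      c^-1 * complex.Re (inner (P x) x).
    by rewrite ler_wpM2l ?invr_ge0 ?(ltW c0).
  have : 0 <= c^-1 * complex.Re (inner (P x) x) by rewrite mulr_ge0// invr_ge0 ltW.
  lra.
(* The membership, symmetry and commutation wanted of [Y] are put into one norm-closed set stable
   under the iteration. *)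
pose C' := [set Y | [/\ C Y, self_adjoint Y &
  forall U, U * P = P * U -> U * Y = Y * U]]%classic.
have BC : C' B.
  split.
  - by apply: ncaB; [exact: (nca_one hC)|exact: ncaZ].
  - apply: self_adjointB => // x y.
    by rewrite !bop_scaleE innerZl innerZconj conjc_real Psa.
  - move=> U UP; rewrite mulrBr mulrBl mulr1 mul1r; congr (_ - _).
    by rewrite bop_scaleAl bop_scaleAr UP.
have [|||Y [[CY Ysa YU] Y1 YE]] := sqrt_fixpoint (C := C') B1.
- split; [exact: nca0|by move=> x y; rewrite inner0l inner0r|].
  by move=> U _; rewrite mulr0 mul0r.
- move=> Y [CY Ysa YU]; case: BC => [CB Bsa BU]; split.
  + by apply: ncaZ; apply: ncaD => //; exact: (nca_mul hC).
  + have h2 : conjc 2^-1 = 2^-1 :> R[i].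
      by rewrite conjc_inv; congr (_^-1); rewrite conjc_nat.
    move=> x y; rewrite !bop_scaleE innerZl innerZconj h2; congr (_ * _).
    by rewrite !bop_addE innerDl innerDr Bsa !bop_mulE !Ysa.
  + move=> U UP; have UB := BU U UP; have UY := YU U UP.
    rewrite bop_scaleAl bop_scaleAr mulrDr mulrDl UB.
    by rewrite mulrA UY -mulrA UY mulrA.
- move=> T hT; split.
  + by apply: (nca_closed hC) => e /hT[S [CS _ _]]; exists S.
  + by apply: norm_closed_self_adjoint => e /hT[S [_ h _]]; exists S.
  + move=> U UP; apply: norm_closed_comm => e /hT[S [_ _ h]].
    by exists S => //; exact: h.
have s0 : 0 <= Num.sqrt c by exact: sqrtr_ge0.
exists ((Num.sqrt c)%:C *: (1 - Y)); split.
- by apply: ncaZ; apply: ncaB => //; exact: (nca_one hC).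
- move=> x; rewrite bop_scaleE innerZl mulr_ge0 ?ler0c//.
  rewrite bop_subE innerBl bop_oneE inner_hnorm.
  have -> : inner (Y x) x = (complex.Re (inner (Y x) x))%:C.
    by apply: conj_fixE; rewrite -innerC Ysa.
  rewrite -rmorphB ler0c subr_ge0.
  have := le_trans (inner_le (Y x) x) (ler_wpM2r (hnorm_ge0 x) (Y1 x)).
  rewrite mul1r expr2; apply: le_trans.
  rewrite -lecR (le_trans _ (_ : `|complex.Re (inner (Y x) x)|%:C <= _))//.
    by rewrite lecR ler_norm.
  by rewrite cabsE normc_ge_Re.
- rewrite bop_scaleAl bop_scaleAr scalerA YE /B opprB addrC subrK scalerA.
  by rewrite -!rmorphM -expr2 sqr_sqrtr ?ltW// mulfV ?gt_eqF// scale1r.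
- move=> U UP; rewrite bop_scaleAl bop_scaleAr.
  by rewrite mulrBr mulrBl mulr1 mul1r (YU U UP).
Qed.

End Algebra.

End Positive.

(** * The trace and its extension to the tensor product *)

Section WeakTopology.
Context {R : realType} {H : hilbertType R}.
Implicit Types (S T U P : bop H) (x y z : H) (a : R[i]) (c d e : R).

(** The sets satisfying the conclusion form a filter [F] whose image under [wot_coef] converges
    pointwise, so [F] contains every weakly open set around [T]. *)
Lemma wot_nbhsP T (U : set (wot H)) : nbhs (T : wot H) U ->
  exists (s : seq (H * H)) (e : R), 0 < e /\ forall S : bop H,
    (forall p, p \in s -> cabs (inner (S p.1) p.2 - inner (T p.1) p.2) < e) ->
    U S.
Proof.
pose F : set_system (bop H) := [set V : set (bop H) |
  exists (s : seq (H * H)) (e : R), 0 < e /\ forall S : bop H,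
    (forall p, p \in s -> cabs (inner (S p.1) p.2 - inner (T p.1) p.2) < e) ->
    V S]%classic.
have FF : Filter F.
  split.
  - by exists [::], 1.
  - move=> V V' [s [e [e0 h]]] [s' [e' [e'0 h']]].
    exists (s ++ s'), (Num.min e e'); split; first by rewrite lt_min e0.
    move=> S hS; split; [apply: h|apply: h'] => p ps.
      by have := hS p; rewrite mem_cat ps lt_min => /(_ isT)/andP[].
    by have := hS p; rewrite mem_cat ps orbT lt_min => /(_ isT)/andP[].
  - move=> V V' VV' [s [e [e0 h]]]; exists s, e; split => // S hS.
    by apply: VV'; exact: h.
have cv : (@wot_coef R H @ F --> (wot_coef T : {ptws (H * H)%type -> R[i]^o}))%classic.
  apply/pointwise_cvgP => p V /nbhs_ballP[d /= d0 dV].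
  have dE : d = (complex.Re d)%:C by rewrite RRe_real// gtr0_real.
  exists [:: p], (complex.Re d); split; first by rewrite -ltcR -dE.
  move=> S /(_ p (mem_head _ _)) hS; apply: dV.
  by rewrite -ball_normE/= distrC dE -cabsE ltcR.
rewrite nbhsE => -[_ [[B Bo <-] BT] BU].
have [|s [e [e0 h]]] := cv B; first exact: open_nbhs_nbhs.
by exists s, e; split => // S hS; apply: BU; exact: h.
Qed.

(** Weak closedness gives norm closedness: [m] dominates each product |x| |y| with (x, y) in [s], so
    an error of e / (m + 1) in norm moves these coefficients by less than [e]. *)
Lemma vna_norm_closed_algebra (A : set (bop H)) : von_neumann_algebra A ->
  norm_closed_algebra A.
Proof.
move=> vA; split; [exact: vna_one|exact: vna_lin|exact: vna_mul|].
move=> T hT; apply: (vna_closed vA) => U /wot_nbhsP[s [e [e0 h]]].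
pose m := \sum_(p <- s) (hnorm p.1 * hnorm p.2).
have m0 : 0 <= m by rewrite sumr_ge0// => p _; rewrite mulr_ge0 ?hnorm_ge0.
have m1 : 0 < m + 1 by rewrite ltr_wpDl.
have [S AS TS] := hT _ (divr_gt0 e0 m1).
exists S; split => //; apply: h => p ps.
rewrite -innerBl -bop_subE (le_lt_trans (inner_le _ _))//.
apply: (@le_lt_trans _ _ (e / (m + 1) * m)).
  have := ler_wpM2r (hnorm_ge0 p.2) (opbd_distC TS p.1); move=> /le_trans; apply.
  rewrite -(mulrA (e / (m + 1))) ler_wpM2l ?divr_ge0 ?(ltW e0) ?(ltW m1)//.
  rewrite /m (big_rem p)//= lerDl sumr_ge0// => p' _.
  by rewrite mulr_ge0 ?hnorm_ge0.
by rewrite mulrAC ltr_pdivrMr// ltr_pM2l// ltrDl.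
Qed.

(** Linear algebra by induction on [s]: [D] is cut down to the kernel of the first coefficient, and
    the value missing at one [T0] outside this kernel is supplied by a multiple of that coefficient,
    the scalar being absorbed into its first vector. *)
Lemma functional_span (s : seq (H * H)) (D : set (bop H)) (g : bop H -> R[i]) :
  (forall a S T, D S -> D T -> D (a *: S + T)) ->
  (forall a S T, D S -> D T -> g (a *: S + T) = a * g S + g T) ->
  (forall T, D T -> (forall p, p \in s -> inner (T p.1) p.2 = 0) -> g T = 0) ->
  exists s' : seq (H * H), forall T, D T -> g T = \sum_(p <- s') inner (T p.1) p.2.
Proof.
elim: s D => [|p s IH] D Dl gl gk.
  by exists [::] => T DT; rewrite big_nil gk.
pose D' := [set T | D T /\ inner (T p.1) p.2 = 0]%classic.
have [s' hs'] : exists s' : seq (H * H),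
    forall T, D' T -> g T = \sum_(p <- s') inner (T p.1) p.2.
  apply: IH => [a S T [DS S0] [DT T0]|a S T [DS _] [DT _]|T [DT T0] hT].
  - split; first exact: Dl.
    by rewrite bop_addE bop_scaleE innerPl S0 T0 mulr0 addr0.
  - exact: gl.
  - by apply: gk => // p'; rewrite inE => /orP[/eqP->//|]; exact: hT.
have [[T0 [DT0 T0n]]|none] := pselect (exists T, D T /\ inner (T p.1) p.2 <> 0);
  last first.
  exists s' => T DT; apply: hs'; split => //; apply: contrapT => n0.
  by apply: none; exists T.
pose k := (g T0 - \sum_(p <- s') inner (T0 p.1) p.2) / inner (T0 p.1) p.2.
exists ((k *: p.1, p.2) :: s') => T DT.
pose r := inner (T p.1) p.2 / inner (T0 p.1) p.2.
have D'T : D' ((- r) *: T0 + T).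
  split; first exact: Dl.
  rewrite bop_addE bop_scaleE innerPl mulNr /r divfK ?addNr//.
  exact/eqP.
have := hs' _ D'T; rewrite gl// big_cons/= => E.
rewrite (_ : T (k *: p.1) = k *: T p.1) ?innerZl; last exact: linearZ.
have -> : g T = r * g T0 + ((- r) * g T0 + g T) by ring.
rewrite E; under eq_bigr do rewrite innerPl.
rewrite big_split/= -mulr_sumr addrA; congr (_ + _).
rewrite mulNr -mulrBr /r /k; ring.
Qed.

(** By weak continuity |phi| < 1 on a neighbourhood of 0 cut out by finitely many coefficients. If
    they all vanish at [T] but phi T does not, then T / phi T lies in that neighbourhood and has
    trace 1, which is absurd; so [functional_span] applies. *)
Lemma trace_vectors (A : set (bop H)) (phi : bop H -> R[i]) :
  von_neumann_algebra A -> is_trace A phi ->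
  exists s : seq (H * H), forall T, A T -> phi T = \sum_(p <- s) inner (T p.1) p.2.
Proof.
move=> vA tA; have hA := vna_norm_closed_algebra vA.
have phi0 : phi 0 = 0.
  have := trace_lin tA (-1) (vna_one vA) (vna_one vA).
  by rewrite scaleN1r addNr mulN1r addNr.
have phiZ a T : A T -> phi (a *: T) = a * phi T.
  by move=> AT; rewrite -[a *: T]addr0 (trace_lin tA)//; [rewrite phi0 addr0|exact: nca0 hA].
have : \forall S \near within A (nbhs (0 : wot H)), cabs (phi S) < 1.
  have /subspace_continuousP/(_ 0 (nca0 hA)) := trace_wcts tA.
  move=> /(_ (ball (phi 0 : R[i]^o) 1) (nbhsx_ballx _ _ ltr01)).
  apply: (@filterS _ (within A (nbhs (0 : wot H)))) => S; rewrite /= -ball_normE/= phi0 sub0r normrN -cabsE.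
  by rewrite -(rmorph1 (real_complex R)) ltcR.
move=> /wot_nbhsP[s [e [e0 h]]].
apply: (@functional_span s A phi); first exact: vna_lin vA.
  exact: trace_lin tA.
move=> T AT T0; apply: contrapT => /eqP n0.
have /h : forall p, p \in s ->
    cabs (inner (((phi T)^-1 *: T) p.1) p.2 - inner ((0 : bop H) p.1) p.2) < e.
  move=> p ps; rewrite bop_scaleE innerZl T0// mulr0 inner0l subr0.
  by rewrite /cabs normr0.
move=> /(_ (ncaZ hA _ AT)); rewrite phiZ// mulVf// /cabs normr1.
by rewrite ltxx.
Qed.

Section Trace.
Context {A : set (bop H)} {phi : bop H -> R[i]}.
Hypotheses (hA : norm_closed_algebra A) (tA : is_trace A phi).

(** Positivity of [phi] is given on products S^* S; a positive [P] has this form through its square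
    root, which stays in [A]. *)
Lemma trace_pos_ge0 P : A P -> pos_bop P -> 0 <= phi P.
Proof.
move=> AP P0; have [S [AS S0 <- _]] := pos_sqrt hA AP P0.
exact: (trace_pos tA AS AS (pos_self_adjoint S0)).
Qed.

Lemma trace_pos_eq0 P : A P -> pos_bop P -> phi P = 0 -> P = 0.
Proof.
move=> AP P0; have [S [AS S0 <- _]] := pos_sqrt hA AP P0.
move=> /(trace_faithful tA AS AS (pos_self_adjoint S0))->.
by rewrite mulr0.
Qed.

End Trace.

End WeakTopology.

(** * Slice maps under norm limits *)

Section Slices.
Context {R : realType} {H K : hilbertType R}.

Lemma opbd_inner (T : bop H) (c : R) : 0 <= c ->
  (forall x y, cabs (inner (T x) y) <= c * hnorm x * hnorm y) -> opbd T c.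
Proof.
move=> c0 h x; have [T0|Tn0] := eqVneq (hnorm (T x)) 0.
  by rewrite T0 mulr_ge0 ?hnorm_ge0.
have Tx : 0 < hnorm (T x) by rewrite lt_def Tn0 hnorm_ge0.
have := h x (T x); rewrite inner_hnorm cabs_real ger0_norm ?exprn_ge0 ?hnorm_ge0//.
by rewrite expr2 ler_pM2r.
Qed.

(** [s] is a slice map with norm at most [c]. If Z_n tends to Z and has slices S_n in [A], the S_n
    are Cauchy with rate 2 c e_n, and their limit is the slice of Z. *)
Lemma norm_closed_slice (A : set (bop H)) (s : bop K -> H -> H -> R[i]) (c : R) :
  norm_closed A -> 0 <= c ->
  (forall Z Z' x y, s (Z - Z') x y = s Z x y - s Z' x y) ->
  (forall Z e x y, 0 <= e -> opbd Z e ->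
    cabs (s Z x y) <= c * e * hnorm x * hnorm y) ->
  norm_closed
    [set Z | exists2 S, A S & forall x y, inner (S x) y = s Z x y]%classic.
Proof.
move=> Acl c0 sB sle Z hZ.
pose e n : R := n.+1%:R^-1.
have e0 n : 0 < e n by rewrite invr_gt0.
have e_small d : 0 < d -> exists n, e n <= d.
  move=> d0; have := archi_boundP (ltW (divr_gt0 ltr01 d0)).
  set n := Num.Def.archi_bound _ => hn; exists n.
  rewrite /e -[d]invrK lef_pV2 ?posrE ?invr_gt0//.
  by rewrite -div1r (le_trans (ltW hn))// ler_nat.
have /choice[T hT] n : exists TS : bop K * bop H, [/\ opbd (Z - TS.1) (e n),
    A TS.2 & forall x y, inner (TS.2 x) y = s TS.1 x y].
  by have [T [S AS ST] ZT] := hZ _ (e0 n); exists (T, S).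
have TT m n : (m <= n)%N -> opbd ((T n).2 - (T m).2) (c * (e m + e m)).
  move=> mn; have [hm _ sm] := hT m; have [hn _ sn] := hT n.
  have nm : e n <= e m by rewrite lef_pV2 ?posrE// ler_nat.
  apply: opbd_inner => [|x y]; first by rewrite mulr_ge0// addr_ge0// ltW.
  rewrite bop_subE innerBl sn sm -sB; apply: sle; first by rewrite addr_ge0// ltW.
  rewrite -(subrK Z (T n).1) -addrA; apply: opbdD => //.
  by apply: opbd_distC; exact: opbd_le hn.
have [|S hS] := bop_lim TT.
  move=> d d0; have c1 : 0 < c + c + 1 by rewrite ltr_wpDl// addr_ge0.
  have [n hn] := e_small _ (divr_gt0 d0 c1); exists n.
  rewrite mulrDr -mulrDl (le_trans (ler_wpM2l _ hn)) ?addr_ge0//.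
  by rewrite mulrCA ger_pMr// ler_pdivrMr// mul1r lerDl.
exists S.
  apply: Acl => d d0; have c1 : 0 < c + c + 1 by rewrite ltr_wpDl// addr_ge0.
  have [n hn] := e_small _ (divr_gt0 d0 c1); have [_ An _] := hT n.
  exists (T n).2 => //; apply: opbd_le (hS n).
  rewrite mulrDr -mulrDl (le_trans (ler_wpM2l _ hn)) ?addr_ge0//.
  by rewrite mulrCA ger_pMr// ler_pdivrMr// mul1r lerDl.
move=> x y; apply/eqP; rewrite -subr_eq0; apply/eqP.
apply: (@cabs_eps0 _ _ ((c + c + c) * hnorm x * hnorm y)) => d d0.
have [n hn] := e_small _ d0; have [ZT _ sT] := hT n.
have -> : inner (S x) y - s Z x y =
    inner ((S - (T n).2) x) y - s (Z - (T n).1) x y.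
  by rewrite bop_subE innerBl sB sT; ring.
rewrite (le_trans (cabsD _ _))// cabsN.
have h1 : cabs (inner ((S - (T n).2) x) y) <= (c * (e n + e n)) * hnorm x * hnorm y.
  by rewrite (le_trans (inner_le _ _))// ler_wpM2r ?hnorm_ge0//; exact: hS.
have h2 := sle _ _ x y (ltW (e0 n)) ZT.
rewrite (le_trans (lerD h1 h2))//.
have -> : c * (e n + e n) * hnorm x * hnorm y + c * e n * hnorm x * hnorm y =
    e n * ((c + c + c) * hnorm x * hnorm y) by ring.
by rewrite ler_wpM2r// !mulr_ge0 ?addr_ge0 ?hnorm_ge0.
Qed.

End Slices.

(** * Operators on the Hilbert tensor product and the functional phi (x) phi *)

Section Tensor.
Context {R : realType} {H : hilbertType R} (K : hilbert_tensor H H).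
Implicit Types (x y : H) (U V : bop H) (Z : bop K).

Lemma hnorm_tens x y : hnorm (tens K x y) = hnorm x * hnorm y.
Proof.
apply/eqP; rewrite -(@eqrXn2 _ 2) ?mulr_ge0 ?hnorm_ge0//; apply/eqP/complexI.
by rewrite -inner_hnorm inner_tens !inner_hnorm -rmorphM exprMn.
Qed.

Lemma tens_eq0 (f : K -> R[i]) (c : R) :
  (forall z w, f (z + w) = f z + f w) ->
  (forall z, cabs (f z) <= c * hnorm z) ->
  (forall x y, f (tens K x y) = 0) -> forall z, f z = 0.
Proof.
move=> fD fc f0 z.
have f00 : f 0 = 0.
  by apply: (@addrI _ (f 0)); rewrite addr0 -fD addr0.
apply: (@cabs_eps0 _ _ `|c|) => e e0.
have e0' : 0 < e%:C :> R[i] by rewrite ltcR.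
have [||w [zw [n [x [y wE]]]]] := @tens_dense _ _ _ K (ball z e%:C).
- by exists z; exact: ballxx.
- exact: ball_open.
have fw : f w = 0 by rewrite wE (big_morph f fD f00) big1.
have -> : f z = f (z - w) by rewrite -[in LHS](subrK w z) (fD (z - w) w) fw addr0.
rewrite (le_trans (fc _))//.
move: zw; rewrite -ball_normE/= -hnormE ltcR => /ltW zw.
rewrite mulrC (le_trans (ler_wpM2l (hnorm_ge0 _) (ler_norm c)))//.
by rewrite ler_wpM2r.
Qed.

Lemma bop_tens_eq0 Z : (forall x y, Z (tens K x y) = 0) -> Z = 0.
Proof.
move=> h; have [c c0 Zc] := opbd_ex Z; apply: bop_eq_inner => z w.
rewrite [RHS]inner0l.
apply: (@tens_eq0 (fun z => inner (Z z) w) (c * hnorm w)).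
- by move=> u v; rewrite linearD innerDl.
- move=> u; rewrite (le_trans (inner_le _ _))// mulrAC ler_wpM2r ?hnorm_ge0//.
- by move=> x y; rewrite h inner0l.
Qed.

Lemma bop_tens_eq Z Z' :
  (forall x y, Z (tens K x y) = Z' (tens K x y)) -> Z = Z'.
Proof.
move=> h; apply/eqP; rewrite -subr_eq0; apply/eqP/bop_tens_eq0 => x y.
by rewrite bop_subE h subrr.
Qed.

Lemma tensor_op1 : tensor_op K 1 1 = 1.
Proof. by apply: bop_tens_eq => x y; rewrite tensor_opE. Qed.

Lemma tensor_opM U V U' V' :
  tensor_op K U V * tensor_op K U' V' = tensor_op K (U * U') (V * V').
Proof. by apply: bop_tens_eq => x y; rewrite bop_mulE !tensor_opE. Qed.

Lemma tensor_op_adjoint U V U' V' : is_adjoint U U' -> is_adjoint V V' ->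
  is_adjoint (tensor_op K U V) (tensor_op K U' V').
Proof.
move=> UU' VV' z w.
set M := tensor_op K U V; set N := tensor_op K U' V'.
have [c c0 Mc] := opbd_ex M; have [d d0 Nd] := opbd_ex N.
have bound z' w' : cabs (inner (M z') w' - inner z' (N w')) <=
    (c + d) * hnorm z' * hnorm w'.
  rewrite (le_trans (cabsD _ _))// cabsN !mulrDl lerD//.
    by rewrite (le_trans (inner_le _ _))// ler_wpM2r ?hnorm_ge0.
  rewrite (le_trans (inner_le _ _))// [d * _]mulrC -mulrA.
  by rewrite ler_wpM2l ?hnorm_ge0.
apply/eqP; rewrite -subr_eq0; apply/eqP.
apply: (@tens_eq0 (fun z => inner (M z) w - inner z (N w)) ((c + d) * hnorm w)).
- by move=> u v; rewrite linearD !innerDl; ring.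
- by move=> u; rewrite mulrAC.
move=> x y; apply: (inv_inj (@conjcK R)); rewrite conjc0.
apply: (@tens_eq0 (fun w => conjc (inner (M (tens K x y)) w - inner (tens K x y) (N w)))
  ((c + d) * hnorm (tens K x y))).
- move=> u v; rewrite -conjcD; congr (conjc _); rewrite linearD !innerDr; ring.
- by move=> u; rewrite cabs_conj.
- move=> x' y'; rewrite /M /N !tensor_opE !inner_tens UU' VV' subrr.
  exact: conjc0.
Qed.

(* The norm closure of the algebraic tensor product, as the least norm-closed
   subspace containing the elementary tensors. *)
Definition tensor_closure (A : set (bop H)) : set (bop K) :=
  [set Z | forall C : set (bop K),
    (forall a S T, C S -> C T -> C (a *: S + T)) -> norm_closed C ->
    (forall U V, A U -> A V -> C (tensor_op K U V)) -> C Z]%classic.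

Lemma tensor_closure_op A U V : A U -> A V -> tensor_closure A (tensor_op K U V).
Proof. by move=> AU AV C _ _ h; exact: h. Qed.

(** The closure is the least norm-closed subspace, so products are handled by two inductions: on the
    left factor when the right one is an elementary tensor, then on the right factor. *)
Lemma tensor_closure_nca A : norm_closed_algebra A ->
  norm_closed_algebra (tensor_closure A).
Proof.
move=> hA.
have lin a S T : tensor_closure A S -> tensor_closure A T ->
    tensor_closure A (a *: S + T).
  by move=> hS hT C Cl Cc Ct; exact: Cl (hS C Cl Cc Ct) (hT C Cl Cc Ct).
have cl : norm_closed (tensor_closure A).
  move=> T hT C Cl Cc Ct; apply: (Cc) => e /hT[S hS ST].
  by exists S => //; exact: (hS C Cl Cc Ct).
have mul1 U V S : A U -> A V -> tensor_closure A S ->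
    tensor_closure A (S * tensor_op K U V).
  move=> AU AV /(_ [set S | tensor_closure A (S * tensor_op K U V)]%classic).
  apply => [a S1 S2 h1 h2|T hT|U' V' AU' AV'] /=.
  - by rewrite mulrDl bop_scaleAl; exact: lin.
  - have [c c0 Wc] := opbd_ex (tensor_op K U V).
    apply: cl => e e0; have [S' /= S'A TS'] := hT _ (divr_gt0 e0 c0).
    exists (S' * tensor_op K U V) => //; rewrite -mulrBl.
    have -> : e = e / c * c by rewrite divfK ?gt_eqF.
    by apply: opbdM => //; rewrite divr_ge0 ?ltW.
  - by rewrite tensor_opM; apply: tensor_closure_op; exact: (nca_mul hA).
split => //.
- by rewrite -tensor_op1; apply: tensor_closure_op; exact: (nca_one hA).
- move=> S T hS /(_ [set T | tensor_closure A (S * T)]%classic); apply.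
  + by move=> a T1 T2 h1 h2 /=; rewrite mulrDr bop_scaleAr; exact: lin.
  + move=> T' hT' /=; have [c c0 Sc] := opbd_ex S.
    apply: cl => e e0; have [S' /= S'A TS'] := hT' _ (divr_gt0 e0 c0).
    exists (S * S') => //; rewrite -mulrBr.
    have -> : e = c * (e / c) by rewrite mulrC divfK ?gt_eqF.
    by apply: opbdM => //; exact: ltW.
  + by move=> U V AU AV /=; exact: mul1.
Qed.

(** The slice (w_x (x) id) Z for the vector functional w_x = <. x, x>: operators whose slice lies in
    [A] form a norm-closed subspace, and U (x) V has slice <U x, x> V. *)
Lemma right_slice A Z x : norm_closed_algebra A -> tensor_closure A Z ->
  exists2 S, A S & forall y y', inner (S y) y' =
    inner (Z (tens K x y)) (tens K x y').
Proof.
move=> hA; move/(_ [set Z | exists2 S, A S & forall y y', inner (S y) y' =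
    inner (Z (tens K x y)) (tens K x y')]%classic); apply.
- move=> a S T [S1 AS1 h1] [T1 AT1 k1]; exists (a *: S1 + T1).
    exact: (nca_lin hA).
  by move=> y y'; rewrite !(bop_addE, bop_scaleE) !innerPl h1 k1.
- apply: (@norm_closed_slice _ _ _ A
    (fun Z y y' => inner (Z (tens K x y)) (tens K x y')) (hnorm x ^+ 2)).
  + exact: nca_closed hA.
  + by rewrite exprn_ge0 ?hnorm_ge0.
  + by move=> *; rewrite bop_subE innerBl.
  + move=> Z' e y y' e0 Ze; rewrite (le_trans (inner_le _ _))//.
    apply: (le_trans (ler_wpM2r (hnorm_ge0 _) (Ze _))).
    by rewrite !hnorm_tens le_eqVlt; apply/orP; left; apply/eqP; ring.
- move=> U V AU AV; exists (inner (U x) x *: V); first exact: (ncaZ hA _ AV).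
  by move=> y y'; rewrite bop_scaleE innerZl tensor_opE inner_tens.
Qed.

(** The slice (id (x) f) Z for the functional f given by [s], which sends U (x) V to f(V) U; the
    closure argument is that of [right_slice]. *)
Lemma left_slice A Z (s : seq (H * H)) : norm_closed_algebra A ->
  tensor_closure A Z ->
  exists2 T, A T & forall x x', inner (T x) x' =
    \sum_(p <- s) inner (Z (tens K x p.1)) (tens K x' p.2).
Proof.
move=> hA; move/(_ [set Z | exists2 T, A T & forall x x', inner (T x) x' =
    \sum_(p <- s) inner (Z (tens K x p.1)) (tens K x' p.2)]%classic); apply.
- move=> a S T [S1 AS1 h1] [T1 AT1 k1]; exists (a *: S1 + T1).
    exact: (nca_lin hA).
  move=> y y'; rewrite !(bop_addE, bop_scaleE) !innerPl h1 k1 mulr_sumr -big_split.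
  by apply: eq_bigr => p _; rewrite innerPl.
- apply: (@norm_closed_slice _ _ _ A (fun Z x x' => \sum_(p <- s)
      inner (Z (tens K x p.1)) (tens K x' p.2))
    (\sum_(p <- s) hnorm p.1 * hnorm p.2)).
  + exact: nca_closed hA.
  + by rewrite sumr_ge0// => p _; rewrite mulr_ge0 ?hnorm_ge0.
  + move=> Z1 Z2 x y; rewrite -sumrB; apply: eq_bigr => p _.
    by rewrite bop_subE innerBl.
  + move=> Z' e y y' e0 Ze; rewrite (le_trans (cabs_sum _ _ _))//.
    rewrite !mulr_suml; apply: ler_sum => p _.
    rewrite (le_trans (inner_le _ _))//.
    apply: (le_trans (ler_wpM2r (hnorm_ge0 _) (Ze _))).
    by rewrite !hnorm_tens le_eqVlt; apply/orP; left; apply/eqP; ring.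
- move=> U V AU AV; exists ((\sum_(p <- s) inner (V p.1) p.2) *: U).
    exact: (ncaZ hA _ AU).
  move=> x x'; rewrite bop_scaleE innerZl mulr_suml; apply: eq_bigr => p _.
  by rewrite tensor_opE inner_tens mulrC.
Qed.

(** When [s] represents [phi] on [A], this is phi (x) phi, here defined on every bounded
    operator. *)
Definition tensor_trace (s : seq (H * H)) Z : R[i] :=
  \sum_(p <- s) \sum_(p' <- s)
    inner (Z (tens K p.1 p'.1)) (tens K p.2 p'.2).

Lemma tensor_traceD s Z Z' :
  tensor_trace s (Z + Z') = tensor_trace s Z + tensor_trace s Z'.
Proof.
rewrite -big_split; apply: eq_bigr => p _ /=; rewrite -big_split.
by apply: eq_bigr => p' _; rewrite innerDl.
Qed.

Lemma tensor_traceZ s a Z : tensor_trace s (a *: Z) = a * tensor_trace s Z.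
Proof.
rewrite mulr_sumr; apply: eq_bigr => p _; rewrite mulr_sumr.
by apply: eq_bigr => p' _; rewrite bop_scaleE innerZl.
Qed.

Section Faithful.
Context {A : set (bop H)} {phi : bop H -> R[i]} {s : seq (H * H)}.
Hypotheses (hA : norm_closed_algebra A) (tA : is_trace A phi).
Hypothesis phiE : forall T, A T -> phi T = \sum_(p <- s) inner (T p.1) p.2.

Lemma tensor_trace_op U V : A U -> A V ->
  tensor_trace s (tensor_op K U V) = phi U * phi V.
Proof.
move=> AU AV; rewrite !phiE// mulr_suml; apply: eq_bigr => p _.
rewrite mulr_sumr; apply: eq_bigr => p' _.
by rewrite tensor_opE inner_tens.
Qed.

(* If Z >= 0, its slices (w_x (x) id) Z and T = (id (x) phi) Z are positive
   elements of A, with w_x T = phi ((w_x (x) id) Z). *)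
Lemma tensor_trace_pos Z : tensor_closure A Z -> pos_bop Z ->
  0 <= tensor_trace s Z /\ (tensor_trace s Z = 0 -> Z = 0).
Proof.
move=> AZ Z0; have [T AT TE] := left_slice s hA AZ.
have phiT : tensor_trace s Z = phi T.
  by rewrite phiE//; apply: eq_bigr => p _; rewrite TE.
have slice x : exists S, [/\ A S, pos_bop S, phi S = inner (T x) x &
    forall y, inner (S y) y = inner (Z (tens K x y)) (tens K x y)].
  have [S AS SE] := right_slice x hA AZ; exists S; split => //.
  - by move=> y; rewrite SE.
  - by rewrite phiE// TE; apply: eq_bigr => p _; rewrite SE.
have T0 : pos_bop T.
  by move=> x; have [S [AS S0 <- _]] := slice x; exact: (trace_pos_ge0 hA tA).
rewrite phiT; split; first exact: (trace_pos_ge0 hA tA).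
(* T = 0 kills the trace of every slice, hence the slice itself by faithfulness; then <Z z, z> = 0
   at z = x (x) y, which gives Z z = 0 by positivity. *)
move=> /(trace_pos_eq0 hA tA AT T0) TT.
apply: bop_tens_eq0 => x y; apply: pos_eq0 => //.
have [S [AS S0 phiS <-]] := slice x.
rewrite (trace_pos_eq0 hA tA AS S0) ?inner0l//.
by rewrite phiS TT inner0l.
Qed.

End Faithful.

End Tensor.

Lemma geometric_le0 (R : realType) (a c t : R) : 0 <= t < 1 ->
  (forall r, (0 < r)%N -> a <= c * t ^+ r) -> a <= 0.
Proof.
move=> /andP[t0 t1] h; rewrite leNgt; apply/negP => a0.
have c1 : 0 < `|c| + 1 by rewrite ltr_wpDl.
have : (t ^+ n @[n --> \oo] --> (0 : R))%classic.
  by apply: cvg_expr; rewrite ger0_norm.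
move=> /(_ _ (nbhsx_ballx (0 : R) _ (divr_gt0 a0 c1))) [n _ hn].
have := hn n.+1 (leqnSn n); rewrite /ball/= sub0r normrN ger0_norm ?exprn_ge0//.
rewrite ltr_pdivlMr// ltNge => /negP; apply.
rewrite (le_trans (h n.+1 _))// mulrC ler_wpM2l ?exprn_ge0//.
by rewrite (le_trans (ler_norm c))// lerDl.
Qed.

Lemma self_adjointX (R : realType) (H : hilbertType R) n (T : bop H) : self_adjoint T -> self_adjoint (T ^+ n).
Proof.
move=> Tsa; elim: n => [x y|n IH x y]; first by rewrite expr0.
by rewrite exprS bop_mulE Tsa IH -bop_mulE -exprSr exprS.
Qed.

(** * Norm bounds from the growth of moments *)

Section SpectralBound.
Context {R : realType} {H : hilbertType R} (K : hilbert_tensor H H).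
Context {A : set (bop H)} {phi : bop H -> R[i]} {s : seq (H * H)}.
Hypotheses (hA : norm_closed_algebra A) (tA : is_trace A phi).
Hypothesis phiE : forall T, A T -> phi T = \sum_(p <- s) inner (T p.1) p.2.

Lemma tensor_trace_le (Z Z' : bop K) : tensor_closure A Z -> tensor_closure A Z' ->
  pos_bop (Z' - Z) ->
  complex.Re (tensor_trace s Z) <= complex.Re (tensor_trace s Z').
Proof.
move=> hZ hZ' /(tensor_trace_pos hA tA phiE (ncaB (tensor_closure_nca K hA) hZ' hZ)).
case=> + _; rewrite tensor_traceD -scaleN1r tensor_traceZ mulN1r subr_ge0.
by rewrite lecE => /andP[].
Qed.

Lemma spectral_bound (N : bop K) (c L L' : R) :
  tensor_closure A N -> self_adjoint N -> 0 <= c -> 0 <= L < L' ->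
  (forall r, (0 < r)%N -> cabs (tensor_trace s (N ^+ r * N ^+ r)) <= c * L ^+ r) ->
  forall x, hnorm (N x) ^+ 2 <= L' * hnorm x ^+ 2.
Proof.
move=> hN Nsa c0 /andP[L0 LL'] hc.
have hT := tensor_closure_nca K hA.
have L'0 : 0 < L' by exact: le_lt_trans LL'.
pose W : bop K := N * N - L'%:C *: (1 : bop K).
have hW : tensor_closure A W.
  apply: (ncaB hT); first exact: (nca_mul hT).
  by apply: (ncaZ hT); exact: (nca_one hT).
have Wsa : self_adjoint W.
  apply: self_adjointB => x y; first by rewrite !bop_mulE !Nsa.
  by rewrite !bop_scaleE innerZl innerZconj conjc_real.
have WW0 : pos_bop (W * W) by move=> x; rewrite bop_mulE Wsa inner_ge0.
have [S [hS S0 SS Scomm]] := pos_sqrt hT (nca_mul hT hW hW) WW0.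
have Ssa := pos_self_adjoint S0.
have WS : W * S = S * W by apply: Scomm; rewrite mulrA.
have NW : N * W = W * N.
  by rewrite mulrBr mulrBl mulrA bop_scaleAl bop_scaleAr mulr1 mul1r.
have NS : N * S = S * N by apply: Scomm; rewrite mulrA NW -mulrA NW mulrA.
(* [Q] is twice the positive part of [W]: [W * Q = S * Q], and [Q = 0] means W = -S <= 0, which is
   the claim. *)
pose Q := S + W.
have hQ : tensor_closure A Q by exact: (ncaD hT).
have Qsa : self_adjoint Q.
  by move=> x y; rewrite !bop_addE innerDl innerDr Ssa Wsa.
have WQ : W * Q = S * Q by rewrite /Q (mulrDr W S W) (mulrDr S S W) SS WS addrC.
have NQ : N * Q = Q * N by rewrite /Q (mulrDr N S W) (mulrDl S W N) NS NW.
have [q q0 Qq] := opbd_ex Q.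
pose E r := N ^+ r * (Q * Q) * N ^+ r.
have hE r : tensor_closure A (E r).
  have hX := ncaX hT r hN.
  exact: (nca_mul hT (nca_mul hT hX (nca_mul hT hQ hQ)) hX).
have NrQ r : N ^+ r * Q = Q * N ^+ r.
  by elim: r => [|r IH]; rewrite ?mulr1 ?mul1r// exprS -mulrA IH mulrA NQ mulrA.
have Nrsa r : self_adjoint (N ^+ r) by exact: self_adjointX.
have Einner r x : inner (E r x) x = (hnorm (Q ((N ^+ r) x)) ^+ 2)%:C.
  by rewrite /E !bop_mulE Nrsa Qsa inner_hnorm.
(* The difference is N^r (Q W Q) N^r = N^r (Q S Q) N^r, a positive operator. *)
have step r : complex.Re (tensor_trace s (L'%:C *: E r)) <=
    complex.Re (tensor_trace s (E r.+1)).
  apply: tensor_trace_le => //; first exact: (ncaZ hT).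
  have -> : E r.+1 - L'%:C *: E r = N ^+ r * (Q * (W * Q)) * N ^+ r.
    have QWQ : Q * (W * Q) = N * (Q * Q) * N - L'%:C *: (Q * Q).
      rewrite /W mulrBl mulrBr bop_scaleAl mul1r bop_scaleAr; congr (_ - _).
      by rewrite -!mulrA -NQ [RHS]mulrA NQ !mulrA.
    rewrite QWQ mulrBr mulrBl bop_scaleAr bop_scaleAl; congr (_ - _).
    by rewrite /E {1}exprSr exprS !mulrA.
  move=> x; rewrite !bop_mulE Nrsa Qsa -(bop_mulE W Q) WQ bop_mulE.
  exact: S0.
have lower r : L' ^+ r * complex.Re (tensor_trace s (E 0)) <=
    complex.Re (tensor_trace s (E r)).
  elim: r => [|r IH]; first by rewrite mul1r.
  rewrite (le_trans _ (step r))// tensor_traceZ exprS -mulrA.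
  have -> z : complex.Re (L'%:C * z) = L' * complex.Re z.
    by case: z => u v /=; rewrite mul0r subr0.
  by rewrite ler_pM2l.
(* Q^2 is bounded by the scalar q^2, where [q] is a norm bound of [Q]; this leaves a moment of
   [N]. *)
have upper r : (0 < r)%N -> complex.Re (tensor_trace s (E r)) <=
    q ^+ 2 * c * L ^+ r.
  move=> r0; apply: (@le_trans _ _
      (complex.Re (tensor_trace s ((q ^+ 2)%:C *: (N ^+ r * N ^+ r))))).
    apply: tensor_trace_le => //.
      exact: (ncaZ hT _ (nca_mul hT (ncaX hT r hN) (ncaX hT r hN))).
    move=> x; rewrite bop_subE innerBl Einner bop_scaleE innerZl bop_mulE Nrsa.
    rewrite inner_hnorm -rmorphM -rmorphB ler0c subr_ge0 -exprMn.
    by rewrite ler_pXn2r ?nnegrE ?mulr_ge0 ?hnorm_ge0 ?(ltW q0)//; exact: Qq.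
  rewrite tensor_traceZ -mulrA.
  have -> z : complex.Re ((q ^+ 2)%:C * z) = q ^+ 2 * complex.Re z.
    by case: z => u v /=; rewrite mul0r subr0.
  rewrite ler_pM2l ?exprn_gt0// (le_trans _ (hc r r0))// (le_trans (ler_norm _))//.
  by rewrite -lecR cabsE normc_ge_Re.
have E00 : pos_bop (E 0) by move=> x; rewrite Einner ler0c exprn_ge0 ?hnorm_ge0.
have [trE0 trE] := tensor_trace_pos hA tA phiE (hE 0) E00.
(* The growth rates L < L' are compatible only if E 0 = Q^2 has trace 0, and then it vanishes by
   faithfulness. *)
have E0 : E 0 = 0.
  apply: trE; rewrite -[LHS]RRe_real ?ger0_real//; congr (_%:C).
  apply/le_anti; rewrite -ler0c RRe_real ?ger0_real// trE0 andbT.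
  apply: (@geometric_le0 _ _ (q ^+ 2 * c) (L / L')).
    by rewrite divr_ge0 ?(ltW L'0)//= ltr_pdivrMr// mul1r.
  move=> r r0; rewrite expr_div_n mulrA ler_pdivlMr ?exprn_gt0// mulrC.
  by rewrite (le_trans (lower r))// upper.
have Q0 x : Q x = 0.
  have := Einner 0 x; rewrite E0 inner0l => /esym/complexI/eqP.
  by rewrite expf_eq0/= hnorm_eq0 => /eqP.
move=> x.
have := S0 x; rewrite (_ : S x = - W x); last first.
  by apply/eqP; rewrite -addr_eq0; apply/eqP; exact: (Q0 x).
rewrite innerNl oppr_ge0 /W bop_subE innerBl bop_mulE Nsa bop_scaleE innerZl.
by rewrite !inner_hnorm -rmorphM subr_le0 lecR.
Qed.

(** For N = M' M, letting L' decrease to b^4 in [spectral_bound] gives |N x| <= b^2 |x|, and |M x|^2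
    = <N x, x>. *)
Lemma opbd_of_moments (M M' : bop K) (b c : R) :
  tensor_closure A M -> tensor_closure A M' -> is_adjoint M M' -> 0 <= b -> 0 <= c ->
  (forall r, (0 < r)%N ->
    cabs (tensor_trace s ((M' * M) ^+ r * (M' * M) ^+ r)) <= c * (b ^+ 4) ^+ r) ->
  opbd M b.
Proof.
move=> hM hM' MM' b0 c0 h x.
have Nsa : self_adjoint (M' * M).
  by move=> y z; rewrite !bop_mulE -MM' innerC -MM' -innerC.
have hN : tensor_closure A (M' * M) by exact: (nca_mul (tensor_closure_nca K hA)).
have N1 : hnorm ((M' * M) x) <= b ^+ 2 * hnorm x.
  rewrite -(@ler_pXn2r _ 2) ?nnegrE ?mulr_ge0 ?exprn_ge0 ?hnorm_ge0//.
  rewrite exprMn -exprM; apply: (@ler_eps _ _ _ (hnorm x ^+ 2)) => e e0.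
  rewrite -mulrDl; apply: (spectral_bound (L := b ^+ 4) hN Nsa c0) => //.
  by rewrite exprn_ge0//= ltrDl.
rewrite -(@ler_pXn2r _ 2) ?nnegrE ?mulr_ge0 ?hnorm_ge0// exprMn.
have := inner_le ((M' * M) x) x.
rewrite bop_mulE innerC -MM' inner_hnorm conjc_real cabs_real.
rewrite ger0_norm ?exprn_ge0 ?hnorm_ge0// => /le_trans; apply.
by rewrite (expr2 (hnorm x)) mulrA ler_wpM2r ?hnorm_ge0.
Qed.

End SpectralBound.

(** * The stochastic integral *)

Section SimpleProcess.
Context {R : realType} {H : hilbertType R} {A : set (bop H)}.
Implicit Types (V : simple_process A).

Lemma sp_time_le V i j : (i <= j <= sp_size V)%N -> sp_time V i <= sp_time V j.
Proof. exact: le_times (@sp_timeS _ _ _ V) i j. Qed.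

Lemma sp_time_ge0 V i : (i <= sp_size V)%N -> 0 <= sp_time V i.
Proof. by move=> ik; rewrite (le_trans (sp_time0 V))// sp_time_le// ik. Qed.

(** At most one of the half-open intervals contains [r], so no cross terms appear. *)
Lemma opnorm_sp_fun V r :
  opnorm (V r) ^+ 2 = \sum_(i < sp_size V) opnorm (sp_val V i) ^+ 2 *
    \1_(`[sp_time V i, sp_time V i.+1[%classic : set R) r.
Proof.
pose I i : set R := `[sp_time V i, sp_time V i.+1[%classic.
have disj (i j : 'I_(sp_size V)) : r \in I i -> r \in I j -> i = j.
  rewrite /I !inE/= !in_itv/= => /andP[ir ri] /andP[jr rj].
  apply: val_inj => /=; have [ij|ji|//] := ltngtP i j.
    have := le_trans (@sp_time_le V i.+1 j _) jr.
    by rewrite ij (ltnW (ltn_ord j)) leNgt ri => /(_ isT).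
  have := le_trans (@sp_time_le V j.+1 i _) ir.
  by rewrite ji (ltnW (ltn_ord i)) leNgt rj => /(_ isT).
have [i ri|none] := pickP (fun i : 'I_(sp_size V) => r \in I i).
  have off (j : 'I_(sp_size V)) : j != i -> \1_(I j) r = 0 :> R.
    by rewrite indicE => ji; case: (boolP (r \in I j)) ji => // /disj/(_ ri)->; rewrite eqxx.
  rewrite /sp_fun (bigD1 i)//= big1 ?addr0 => [|j ji]; last first.
    by rewrite (off j ji) scale0r.
  rewrite [RHS](bigD1 i)//= big1 ?addr0 => [|j ji]; last by rewrite (off j ji) mulr0.
  by rewrite indicE ri scale1r mulr1.
rewrite /sp_fun !big1 => [|i _|i _]; first by rewrite opnorm0 expr0n.
  by rewrite indicE none mulr0.
by rewrite indicE none scale0r.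
Qed.

Lemma integral_sp_fun V :
  \int[lebesgue_measure]_(r in `[0, +oo[%classic) opnorm (V r) ^+ 2 =
  \sum_(i < sp_size V) opnorm (sp_val V i) ^+ 2 *
    (sp_time V i.+1 - sp_time V i).
Proof.
rewrite /Rintegral; under eq_integral.
  move=> r _; rewrite opnorm_sp_fun -sumEFin.
  under eq_bigr do rewrite EFinM.
  over.
have mI i : measurable (`[sp_time V i, sp_time V i.+1[%classic : set R).
  exact: measurable_itv.
rewrite ge0_integral_sum//=; last 2 first.
- move=> i; apply: measurable_funeM; apply/measurable_EFinP.
  exact: measurable_indic.
- by move=> i x _; rewrite -EFinM lee_fin mulr_ge0 ?exprn_ge0 ?opnorm_ge0.
rewrite (eq_bigr (fun i : 'I_(sp_size V) => (opnorm (sp_val V i) ^+ 2 *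
    (sp_time V i.+1 - sp_time V i))%:E)); first by rewrite sumEFin.
move=> i _; rewrite ge0_integralZl_EFin//=; last 2 first.
- by apply/measurable_EFinP; exact: measurable_indic.
- by rewrite exprn_ge0 ?opnorm_ge0.
rewrite integral_indic//= [RHS]EFinM; congr (_ * _)%E.
(* The intervals already lie in [0, +oo[, the times being nonnegative. *)
rewrite (_ : _ `&` _ = `[sp_time V i, sp_time V i.+1[)%classic; last first.
  rewrite setIidl// => r /=; rewrite !in_itv/= andbT => /andP[ir _].
  by rewrite (le_trans _ ir)// sp_time_ge0// ltnW.
by rewrite lebesgue_measure_itv/= lte_fin sp_timeS.
Qed.

End SimpleProcess.

Lemma is_adjoint_sum (R : realType) (H : hilbertType R) (I : finType)
    (S T : I -> bop H) :
  (forall i, is_adjoint (S i) (T i)) -> is_adjoint (\sum_i S i) (\sum_i T i).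
Proof.
move=> h; elim/big_ind2: _ => [x y|S1 T1 S2 T2 h1 h2 x y|i _]; last exact: h.
  by rewrite inner0l inner0r.
by rewrite !bop_addE innerDl innerDr h1 h2.
Qed.

(** * Trace estimates for words in the increments *)

Section Words.
Context {R : realType} {H : hilbertType R}.
Context {A : set (bop H)} {phi : bop H -> R[i]}.
Hypotheses (hA : norm_closed_algebra A) (tA : is_trace A phi).

Lemma opbd_adjoint (T T' : bop H) (c : R) : 0 <= c -> is_adjoint T T' ->
  opbd T c -> opbd T' c.
Proof.
move=> c0 TT' Tc; apply: opbd_inner => // x y.
rewrite innerC -TT' cabs_conj (le_trans (inner_le _ _))// mulrAC.
by rewrite ler_wpM2r ?hnorm_ge0.
Qed.

Lemma nca_prod (C : set (bop H)) n (T : 'I_n -> bop H) : norm_closed_algebra C ->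
  (forall j, C (T j)) -> C (\prod_j T j).
Proof.
move=> hC hT; elim/big_ind: _ => //; first exact: nca_one hC.
exact: nca_mul hC.
Qed.

Lemma opbd_prod n (T : 'I_n -> bop H) (c : 'I_n -> R) :
  (forall j, opbd (T j) (c j)) -> (forall j, 0 <= c j) ->
  opbd (\prod_j T j) (\prod_j c j).
Proof.
move=> h c0; suff [] : opbd (\prod_j T j) (\prod_j c j) /\ 0 <= \prod_j c j by [].
elim/big_ind2: _ => [|S a S' a' [Sa a0] [Sa' a0']|j _]; last by [].
  by split; [exact: opbd1|exact: ler01].
by split; [exact: opbdM|exact: mulr_ge0].
Qed.

Lemma trace_sum (I : finType) (c : I -> R[i]) (T : I -> bop H) :
  (forall i, A (T i)) -> phi (\sum_i c i *: T i) = \sum_i c i * phi (T i).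
Proof.
move=> hT; suff [] : A (\sum_i c i *: T i) /\
    phi (\sum_i c i *: T i) = \sum_i c i * phi (T i) by [].
elim/big_rec2: _ => [|i a S _ [AS <-]]; last first.
  split; first by apply: (nca_lin hA).
  exact: (trace_lin tA).
split; first exact: nca0 hA.
have := trace_lin tA (-1) (nca_one hA) (nca_one hA).
by rewrite scaleN1r addNr mulN1r addNr.
Qed.

(** Each increment is a signed sum over its two end points; expanding the product leaves moments of
    [X], which [q_moment_increments] sums up again. *)
Lemma q_increments_moment (q : R) (X : R -> bop H) (k n : nat) (t : nat -> R)
    (f : 'I_n -> 'I_k) : q_brownian_motion A phi q X ->
  (forall i, (i <= k)%N -> 0 <= t i) ->
  (forall i, (i < k)%N -> t i < t i.+1) -> (0 < n)%N ->
  phi (\prod_j (X (t (f j).+1) - X (t (f j)))) =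
  (\sum_(P in pairings n) q ^+ #|crossings P| * \prod_(p in pair_set P)
    (if f p.1 == f p.2 then t (f p.1).+1 - t (f p.1) else 0))%:C.
Proof.
move=> hX t0 t_lt n0; rewrite -q_moment_increments//.
have tb (b : bool) (i : 'I_k) : 0 <= t (i + b)%N.
  by apply: t0; case: b; rewrite ?addn1 ?addn0// ltnW.
pose sg (b : bool) : R[i] := (-1) ^+ (~~ b).
have -> : \prod_j (X (t (f j).+1) - X (t (f j))) =
    \prod_j \sum_(b : bool) sg b *: X (t (f j + b)%N).
  apply: eq_bigr => j _; rewrite big_bool/= addn0 addn1 /sg/= expr0 expr1.
  by rewrite scale1r scaleN1r.
rewrite bigA_distr_bigA/=.
have scaleprod (b : {ffun 'I_n -> bool}) :
    \prod_j (sg (b j) *: X (t (f j + b j)%N)) =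
    (\prod_j sg (b j)) *: \prod_j X (t (f j + b j)%N).
  apply: (big_ind3 (fun (S : bop H) (a : R[i]) (T : bop H) => S = a *: T)).
  - by rewrite scale1r.
  - by move=> S a T S' a' T' -> ->; rewrite bop_scaleAl bop_scaleAr scalerA.
  - by [].
under eq_bigr do rewrite scaleprod.
rewrite trace_sum; last by move=> b; apply: nca_prod => // j; apply: (qbm_mem hX).
rewrite rmorph_sum; apply: eq_bigr => b _.
rewrite (qbm_moment hX)// rmorphM rmorph_prod; congr (_ * _).
by apply: eq_bigr => j _; rewrite /sg rmorphXn rmorphN1.
Qed.

End Words.

Section TensorWords.
Context {R : realType} {H : hilbertType R} (K : hilbert_tensor H H).
Context {A : set (bop H)} {phi : bop H -> R[i]} {s : seq (H * H)}.
Hypotheses (hA : norm_closed_algebra A) (tA : is_trace A phi).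
Hypothesis phiE : forall T, A T -> phi T = \sum_(p <- s) inner (T p.1) p.2.

(** The constant need not be sharp: it is independent of the length of words, hence harmless for the
    growth rate of moments. *)
Lemma trace_le (T : bop H) (c : R) : A T -> opbd T c ->
  cabs (phi T) <= (\sum_(p <- s) hnorm p.1 * hnorm p.2) * c.
Proof.
move=> AT Tc; rewrite phiE// (le_trans (cabs_sum _ _ _))// mulr_suml.
apply: ler_sum => p _; rewrite (le_trans (inner_le _ _))//.
by rewrite mulrAC ler_wpM2r ?hnorm_ge0// mulrC.
Qed.

(** On each elementary tensor of the expansion, phi (x) phi splits into the trace of a word in the
    [U j i], bounded through norms, and a moment of increments, controlled by [sum_moments_le]. [U]
    depends on the position [j] so that an operator and its adjoint may alternate. *)
Lemma tensor_trace_word_le (q : R) (X : R -> bop H) (k n : nat) (t : nat -> R)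
    (U : 'I_n -> 'I_k -> bop H) (v : 'I_k -> R) :
  q_brownian_motion A phi q X -> `|q| < 1 ->
  (forall i, (i <= k)%N -> 0 <= t i) ->
  (forall i, (i < k)%N -> t i < t i.+1) -> (0 < n)%N -> 'I_k ->
  (forall j i, A (U j i)) -> (forall i, 0 <= v i) ->
  (forall j i, opbd (U j i) (v i)) ->
  cabs (tensor_trace s (\prod_(j < n) \sum_(i < k)
    tensor_op K (U j i) (X (t i.+1) - X (t i)))) <=
  (\sum_(p <- s) hnorm p.1 * hnorm p.2) * (2 / Num.sqrt (1 - `|q|) *
    Num.sqrt (\sum_i v i ^+ 2 * (t i.+1 - t i))) ^+ n.
Proof.
move=> hX q1 t0 t_lt n0 k0 AU v0 Uv; set C := \sum_(p <- s) _.
have C0 : 0 <= C by rewrite sumr_ge0// => p _; rewrite mulr_ge0 ?hnorm_ge0.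
have AX (i : 'I_k) : A (X (t i.+1) - X (t i)).
  by apply: (ncaB hA); apply: (qbm_mem hX); apply: t0 => //; exact: ltnW.
rewrite bigA_distr_bigA/=.
have word (f : {ffun 'I_n -> 'I_k}) :
    \prod_j tensor_op K (U j (f j)) (X (t (f j).+1) - X (t (f j))) =
    tensor_op K (\prod_j U j (f j)) (\prod_j (X (t (f j).+1) - X (t (f j)))).
  apply: (big_ind3 (fun (Z : bop K) (S T : bop H) => Z = tensor_op K S T)).
  - by rewrite tensor_op1.
  - by move=> Z S T Z' S' T' -> ->; rewrite tensor_opM.
  - by [].
under eq_bigr do rewrite word.
have tr0 : tensor_trace s (0 : bop K) = 0.
  by have := tensor_traceZ s 0 (0 : bop K); rewrite scale0r mul0r.
rewrite (big_morph _ (tensor_traceD s) tr0).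
rewrite (le_trans (cabs_sum _ _ _))//.
pose d (i : 'I_k) := t i.+1 - t i.
have d0 i : 0 <= d i by rewrite subr_ge0 ltW// t_lt.
apply: le_trans (ler_wpM2l C0 (sum_moments_le q1 k0 v0 d0 n)).
rewrite mulr_sumr; apply: ler_sum => f _.
have AUf : A (\prod_j U j (f j)) by exact: nca_prod.
rewrite (tensor_trace_op K phiE)//; last by apply: nca_prod.
rewrite cabsM (q_increments_moment hA tA f hX t0 t_lt n0) cabs_real mulrA.
rewrite ler_wpM2r// trace_le//; exact: opbd_prod.
Qed.

End TensorWords.

(** * The norm inequality for simple processes *)

Unset Implicit Arguments.
Local Close Scope complex_scope.

Local Open Scope classical_set_scope.
Local Open Scope ring_scope.

Theorem proposition3p2 (R : realType) (H : hilbertType R)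
    (A : set (bop H)) (phi : bop H -> R[i])
    (Aphi : nc_probability_space A phi) (K : hilbert_tensor H H)
    (q : R) (q_gtN1 : -1 < q) (q_lt1 : q < 1)
    (X : R -> bop H) (X_qbm : q_brownian_motion A phi q X)
    (V : simple_process A) :
  opnorm (stoch_int K V X) <=
  2 / Num.sqrt (1 - `|q|) *
  Num.sqrt (\int[lebesgue_measure]_(s in `[0, +oo[) (opnorm (V s)) ^+ 2).
Proof.
have q1 : `|q| < 1 by rewrite ltr_norml q_gtN1.
have vA := ncps_vna Aphi; have tA := ncps_trace Aphi.
have hA := vna_norm_closed_algebra vA.
have [s phiE] := trace_vectors vA tA.
rewrite integral_sp_fun; set b := (_ / _ * _).
have b0 : 0 <= b by rewrite mulr_ge0 ?divr_ge0 ?sqrtr_ge0.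
apply: opnorm_le => //.
(* The word estimate asks for an index of a time interval, so the empty process is treated apart. *)
have [k0|k_gt0] := posnP (sp_size V).
  have -> : stoch_int K V X = 0.
    by rewrite /stoch_int big1// => -[i /=]; rewrite k0.
  by apply: opbd_le b0 _; exact: opbd0.
have adj (i : 'I_(sp_size V)) : {U | A U /\ is_adjoint (sp_val V i) U}.
  by apply: cid; have [U AU h] := vna_adj vA (sp_mem (ltn_ord i)); exists U.
(* [true] selects V_i and [false] its adjoint, so that [M true] is the integral and [M false] its
   adjoint. *)
pose U (o : bool) (i : 'I_(sp_size V)) := if o then sp_val V i else sval (adj i).
have AU o i : A (U o i).
  by case: o => /=; [exact: sp_mem|case: (svalP (adj i))].
pose v (i : 'I_(sp_size V)) := opnorm (sp_val V i).
have v0 i : 0 <= v i by exact: opnorm_ge0.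
have Uv o i : opbd (U o i) (v i).
  case: o => /=; first exact: opbd_opnorm.
  by have [_ h] := svalP (adj i); exact: opbd_adjoint (v0 i) h (opbd_opnorm _).
pose t := sp_time V.
have t0 i : (i <= sp_size V)%N -> 0 <= t i by exact: sp_time_ge0.
have t_lt i : (i < sp_size V)%N -> t i < t i.+1 by exact: sp_timeS.
pose M o : bop K := \sum_(i < sp_size V)
  tensor_op K (U o i) (X (t i.+1) - X (t i)).
have cM o : tensor_closure A (M o).
  have hT := tensor_closure_nca K hA.
  rewrite /M; elim/big_ind: _ => [|S T|i _]; first exact: nca0 hT.
    exact: (ncaD hT).
  apply: tensor_closure_op => //; apply: (ncaB hA); apply: (qbm_mem X_qbm).
    exact: t0.
  by apply: t0; exact: ltnW.
have MM : is_adjoint (M true) (M false).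
  apply: is_adjoint_sum => i; apply: tensor_op_adjoint.
    by case: (svalP (adj i)).
  apply: self_adjointB; apply: (qbm_sa X_qbm); last by apply: t0; exact: ltnW.
  exact: t0.
pose C := \sum_(p <- s) hnorm p.1 * hnorm p.2.
have C0 : 0 <= C by rewrite sumr_ge0// => p _; rewrite mulr_ge0 ?hnorm_ge0.
apply: (opbd_of_moments hA tA phiE (cM true) (cM false) MM b0 C0) => r r0.
(* The (2r)-th power of M^* M is an alternating word of 4r factors, whose position 0 carries M^*,
   that is, [M false]. *)
have -> : (M false * M true) ^+ r * (M false * M true) ^+ r =
    \prod_(j < (r + r).*2) M (odd j).
  rewrite -exprD; elim: (r + r)%N => [|m IH]; first by rewrite expr0 big_ord0.
  by rewrite doubleS !big_ord_recr/= odd_double -IH exprSr mulrA.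
rewrite -exprM (_ : (4 * r = (r + r).*2)%N); last by lia.
have r2 : (0 < (r + r).*2)%N by rewrite double_gt0 addn_gt0 r0.
exact: (tensor_trace_word_le K hA tA phiE X_qbm q1 t0 t_lt r2 (Ordinal k_gt0)
  (fun (j : 'I_(r + r).*2) i => AU (odd j) i) v0 (fun j i => Uv (odd j) i)).
Qed.
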